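(* Let $K$ be an uncountable compact metric space and let $d\in \mathbb{N}^+$. Then for a prevalent $f\in C(K,\mathbb{R}^d)$ we have \[ \dim_H \operatorname{graph}(f)=\dim_H K+d. \]
   Context: $C(K,\mathbb{R}^d)$ is the Banach space of continuous maps $K\to\mathbb{R}^d$ with the maximum norm, viewed as an abelian Polish group. A set $A\subset G$ in an abelian Polish group is shy if there exist a Borel set $B\supset A$ and a Borel probability measure $\mu$ on $G$ with $\mu(B+x)=0$ for all $x\in G$; prevalent means complement shy; ''for a prevalent $f$'' means the set of such $f$ contains a prevalent set. $K\times\mathbb{R}^d$ carries the metric $\sqrt{\rho(x_1,x_2)^2+|z_1-z_2|^2}$ and $\operatorname{graph}(f)=\{(x,f(x)):x\in K\}$. $\dim_H$ denotes Hausdorff dimension. *)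

(* Defs.v *)
From HB Require Import structures.
From mathcomp Require Import all_boot all_order all_algebra.
From mathcomp Require Import all_classical all_reals.
From mathcomp Require Import ereal topology normedtype sequences measure exp.
Set Implicit Arguments. Unset Strict Implicit. Unset Printing Implicit Defensive.
Import Order.TTheory GRing.Theory Num.Theory.
Local Open Scope classical_set_scope.
Local Open Scope ring_scope.

Section Defs.
Variable R : realType.

Definition is_metric (X : Type) (dist : X -> X -> R) : Prop :=
  [/\ forall x y, 0 <= dist x y,
      forall x y, dist x y = 0 <-> x = y,
      forall x y, dist x y = dist y x &
      forall x y z, dist x z <= dist x y + dist y z].

Definition mopen (X : Type) (dist : X -> X -> R) (U : set X) : Prop :=
  forall x, U x -> exists2 e : R, 0 < e & forall y, dist x y < e -> U y.

Definition mcompact (X : Type) (dist : X -> X -> R) : Prop :=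
  forall (I : Type) (U : I -> set X), (forall i, mopen dist (U i)) ->
    (forall x, exists i, U i x) ->
    exists (n : nat) (g : 'I_n -> I), forall x, exists j, U (g j) x.

Definition uncountable (X : Type) : Prop :=
  ~ exists f : X -> nat, injective f.

Local Open Scope ereal_scope.

Definition diam (X : Type) (dist : X -> X -> R) (A : set X) : \bar R :=
  ereal_sup [set (dist x y)%:E | x in A & y in A].

Definition diam_pow (X : Type) (dist : X -> X -> R) (s : R) (U : set X) : R :=
  if `[< U = set0 >] then 0%R else powR (fine (diam dist U)) s.

Definition hausdorff_delta (X : Type) (dist : X -> X -> R) (s delta : R)
    (A : set X) : \bar R :=
  ereal_inf [set (\sum_(n <oo) (diam_pow dist s (U n))%:E) |
             U in [set U : (set X)^nat |
                     A `<=` \bigcup_n U n /\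
                     forall n, diam dist (U n) <= delta%:E]].

(** the s-dimensional Hausdorff measure H^s = lim_{delta -> 0+} H^s_delta *)
Definition hausdorff_measure (X : Type) (dist : X -> X -> R) (s : R)
    (A : set X) : \bar R :=
  ereal_sup [set hausdorff_delta dist s delta A | delta in [set d : R | (0 < d)%R]].

Definition hausdorff_dim (X : Type) (dist : X -> X -> R) (A : set X) : \bar R :=
  ereal_inf [set s%:E | s in [set s : R | (0 <= s)%R /\
                                          hausdorff_measure dist s A = 0]].
Local Close Scope ereal_scope.

Definition eucl (d : nat) (z : 'I_d -> R) : R := Num.sqrt (\sum_i (z i) ^+ 2).

Section CK.
Variables (K : Type) (rho : K -> K -> R) (d : nat).

Definition mcontinuous (f : K -> 'I_d -> R) : Prop :=
  forall x (e : R), 0 < e -> exists2 del : R, 0 < del &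
    forall y, rho x y < del -> eucl (fun i => f x i - f y i) < e.

Definition CK : set (K -> 'I_d -> R) := [set f | mcontinuous f].

Definition supdist (f g : K -> 'I_d -> R) : R :=
  sup [set eucl (fun i => f x i - g x i) | x in [set: K]].

Definition CK_open (U : set (K -> 'I_d -> R)) : Prop :=
  U `<=` CK /\
  forall f, U f -> exists2 e : R, 0 < e &
    forall g, CK g -> supdist f g < e -> U g.

Definition CK_borel : set (set (K -> 'I_d -> R)) := <<s CK, CK_open >>.

Definition CK_borel_prob (mu : set (K -> 'I_d -> R) -> \bar R) : Prop :=
  [/\ mu set0 = 0%E,
      forall A, CK_borel A -> (0 <= mu A)%E,
      forall F : (set (K -> 'I_d -> R))^nat,
        (forall n, CK_borel (F n)) -> trivIset setT F ->
        (fun n => \sum_(0 <= i < n) mu (F i))%E @ \oo --> mu (\bigcup_n F n) &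
      mu CK = 1%E].

Definition translate (B : set (K -> 'I_d -> R)) (x : K -> 'I_d -> R) :=
  [set (fun y i => b y i + x y i) | b in B].

Definition shy (A : set (K -> 'I_d -> R)) : Prop :=
  A `<=` CK /\
  exists2 B, CK_borel B /\ A `<=` B &
    exists2 mu, CK_borel_prob mu & forall x, CK x -> mu (translate B x) = 0%E.

Definition prevalent (A : set (K -> 'I_d -> R)) : Prop :=
  A `<=` CK /\ shy (CK `\` A).

Definition for_prevalent (P : (K -> 'I_d -> R) -> Prop) : Prop :=
  exists2 A, prevalent A & forall f, A f -> P f.

Definition graph_dist (p q : K * ('I_d -> R)) : R :=
  Num.sqrt (rho p.1 q.1 ^+ 2 + eucl (fun i => p.2 i - q.2 i) ^+ 2).

Definition graph (f : K -> 'I_d -> R) : set (K * ('I_d -> R)) :=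
  [set (x, f x) | x in [set: K]].
End CK.
End Defs.

(* Main.v *)
Require Import Defs.
From HB Require Import structures.
From mathcomp Require Import all_boot all_order all_algebra.
From mathcomp Require Import all_classical all_reals.
From mathcomp Require Import ereal topology normedtype sequences measure exp.
From mathcomp Require Import lebesgue_measure.
From mathcomp Require Import ring lra.
Set Implicit Arguments. Unset Strict Implicit. Unset Printing Implicit Defensive.
Import Order.TTheory GRing.Theory Num.Theory.
Import numFieldNormedType.Exports.
Local Open Scope classical_set_scope.
Local Open Scope ring_scope.

(** The upper bound holds for every continuous [f]: a cover of [K] by sets of diameter [r]
    is refined by cubes of side [r] in the range of [f].

    For the lower bound, let [F] be a random sum, over scales [n], of [a_n] times the
    distance to the nearest integer of a random combination of bumps adapted to a net of
    [K]. If [rho x y] is at least the scale [n], some bump equals [1] at [x] and [0] at [y],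
    and resampling its coefficient shows that [F x - F y] lies in a given cube of side [u]
    with probability at most a constant times [(u / a_n) ^ d], whatever continuous [g] is
    added to [F]. Hence if [K] carries measures of bounded energy for a suitable kernel, the
    graph of [F + g] carries measures of bounded expected [s]-energy, and a cover of that
    graph with small [s]-sum exists only with small probability. The measures come from a
    near-minimizer of the energy on a fine net, whose potential is large everywhere, so that
    a Vitali selection of balls covers [K] economically; when [K] has dimension zero they
    come from a Cantor set in [K], which then dictates the scales. The shyness witness is
    the law of [F], with Lebesgue measure on [0, 1[ as probability space. *)

(** * Concentration of one random wave *)

Section Triangle.
Variable R : realType.
Implicit Types (s t u v a C : R).

(** The order of the choices shapes the proof. Small covers with scales down to [dyad J] form an
    open condition on the function, so they can be tested on the first [N] digits; but [N] is chosen
    after [J], and the energy bound may depend on neither. Hence finitely supported measures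
    suffice, one for each [N], and no weak limit is taken. Pairs of points too close to be separated
    by the first [N] stages are paid for by the last weight [kappa s N], which exceeds any bound
    because [d > 0] and [1 / a_n] is unbounded.

    The amplitudes [a_n] are differences of consecutive inverses of integers: their sum is finite,
    and [1 / a_n] grows only quadratically, so that the loss [(1 / a_n) ^ d] is beaten by any
    geometric decay. If some [t > 0] has nonzero Hausdorff measure, this decay comes from
    [t > s - d], at the scales [D / 2 ^ n]. In dimension zero there is no such [t]; the scales
    follow the Cantor set and may shrink arbitrarily fast. This is harmless since only [s < d]
    matters there, for which the sum of [u ^ (d - s)] over all dyadic [u] converges. *)

Definition tri t : R := `| t - (Num.floor (t + 2^-1))%:~R |.

Lemma tri_le_dist t (m : int) : tri t <= `| t - m%:~R |.
Proof.
rewrite /tri; set f := Num.floor _.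
have /andP[h1 h2] : f%:~R <= t + 2^-1 < (f + 1)%:~R.
  by rewrite floor_le_tmp floorD1_gt.
rewrite intrD in h2.
case: (ltrgtP m f) => [mf|fm|-> //].
- have : (m + 1)%:~R <= f%:~R :> R by rewrite ler_int lezD1.
  rewrite intrD => h; rewrite [leRHS]ger0_norm; last by lra.
  by rewrite ler_norml; apply/andP; split; lra.
- have : (f + 1)%:~R <= m%:~R :> R by rewrite ler_int lezD1.
  rewrite intrD => h; rewrite [leRHS]ler0_norm; last by lra.
  by rewrite ler_norml; apply/andP; split; lra.
Qed.

Lemma tri_bound t : 0 <= tri t <= 2^-1.
Proof.
rewrite normr_ge0 /tri; set f := Num.floor _.
have /andP[h1 h2] : f%:~R <= t + 2^-1 < (f + 1)%:~R.
  by rewrite floor_le_tmp floorD1_gt.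
by rewrite intrD in h2; rewrite ler_norml; apply/andP; split; lra.
Qed.

Lemma tri_lip s t : `| tri s - tri t | <= `| s - t |.
Proof.
suff H x y : tri x - tri y <= `|x - y|.
  by rewrite ler_norml H andbT lerNl opprB distrC H.
rewrite lerBlDr.
apply: le_trans (tri_le_dist x (Num.floor (y + 2^-1))) _.
rewrite [tri y]/tri; set m := _%:~R.
by apply: le_trans (ler_normD _ _); rewrite addrA subrK.
Qed.

Lemma tri_low t (m : int) : m%:~R <= t -> t < m%:~R + 2^-1 -> tri t = t - m%:~R.
Proof.
move=> h1 h2; rewrite /tri.
have -> : Num.floor (t + 2^-1) = m.
  by apply/floor_def; rewrite intrD; apply/andP; split; lra.
by rewrite ger0_norm //; lra.
Qed.

Lemma tri_high t (m : int) : m%:~R + 2^-1 <= t -> t < m%:~R + 1 ->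
  tri t = m%:~R + 1 - t.
Proof.
move=> h1 h2; rewrite /tri.
have -> : Num.floor (t + 2^-1) = (m + 1)%R.
  by apply/floor_def; rewrite !intrD; apply/andP; split; lra.
by rewrite intrD ler0_norm ?opprB //; lra.
Qed.

Lemma sum_ind_card (T : finType) (P : pred T) :
  \sum_(k : T) (P k)%:R = #|P|%:R :> R.
Proof. by rewrite -natr_sum -big_mkcond -sum1_card. Qed.

Lemma card_close (g : nat) (P : pred 'I_g) (D : R) : 0 <= D ->
  (forall i j, P i -> P j -> (i%:R - j%:R : R) <= D) -> #|P|%:R <= D + 1.
Proof.
move=> D0 h; case: (pickP P) => [i0 Pi0|P0]; last first.
  by rewrite (eq_card0 P0) addr_ge0.
pose lo := [arg min_(i < i0 | P i) (val i)]; pose hi := [arg max_(i > i0 | P i) (val i)].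
have [Plo lomin] : P lo /\ forall i, P i -> (lo <= i)%N.
  by rewrite /lo; case: arg_minnP => // i Pi ?; split.
have [Phi himax] : P hi /\ forall i, P i -> (i <= hi)%N.
  by rewrite /hi; case: arg_maxnP => // i Pi ?; split.
have lohi := lomin _ Phi.
have cardP : (#|P| <= (hi - lo).+1)%N.
  rewrite cardE -(size_map val) -(size_iota lo (hi - lo).+1).
  apply: uniq_leq_size; first by rewrite map_inj_uniq ?enum_uniq //; exact: val_inj.
  move=> x /mapP[i]; rewrite mem_enum => Pi ->.
  by rewrite mem_iota lomin //= addnS ltnS subnKC // himax.
apply: (@le_trans _ _ (hi - lo).+1%:R); first by rewrite ler_nat.
by rewrite -addn1 natrD lerD2r natrB // h.
Qed.

(** The points [C + k / g.+1] sweep one period, hence meet at most four half-integer intervals, on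
    each of which [tri] is affine of slope 1 or -1. The admissible points of one interval are within
    [2 * u / a] of each other, so there are at most [2 * X + 1] of them, where [X = g.+1 * u / a].
    The hypotheses give [1 <= X], and 12 comes from [4 * (2 * X + 1) <= 12 * X]. *)
Lemma tri_count (g : nat) (a u v C : R) : 0 < a <= 1 -> (g.+1%:R)^-1 <= u ->
  \sum_(k < g.+1) (`| v + a * tri (C + k%:R / g.+1%:R) | <= u)%R%:R
    <= 12 * u / a * g.+1%:R.
Proof.
move=> /andP[a0 a1] gu; set G : R := g.+1%:R.
have G0 : 0 < G by rewrite ltr0n.
have u0 : 0 < u by apply: lt_le_trans gu; rewrite invr_gt0.
pose m := Num.floor C.
have /andP[m1 m2] : m%:~R <= C < (m + 1)%:~R by rewrite floor_le_tmp floorD1_gt.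
rewrite intrD in m2.
pose p k : R := C + k%:R / G.
pose E (k : 'I_g.+1) := `| v + a * tri (p k) | <= u.
pose c1 (k : 'I_g.+1) := p k < m%:~R + 2^-1.
pose c2 (k : 'I_g.+1) := m%:~R + 2^-1 <= p k < m%:~R + 1.
pose c3 (k : 'I_g.+1) := m%:~R + 1 <= p k < m%:~R + 1 + 2^-1.
pose c4 (k : 'I_g.+1) := m%:~R + 1 + 2^-1 <= p k.
have pge k : C <= p k by rewrite lerDl divr_ge0 // ltW.
have plt (k : 'I_g.+1) : p k < m%:~R + 2.
  have : k%:R / G < 1 :> R by rewrite ltr_pdivrMr // mul1r ltr_nat.
  by rewrite /p; move: (k%:R / G) => w; lra.
have step (c : pred 'I_g.+1) (e : R) (w : R) : e ^+ 2 = 1 ->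
    (forall k, c k -> tri (p k) = e * p k + w) ->
    \sum_(k < g.+1) (E k && c k)%:R <= G * (2 * u / a) + 1.
  move=> e2 hc; rewrite sum_ind_card; apply: card_close.
    by rewrite mulr_ge0 ?ltW // divr_gt0 // mulr_gt0.
  move=> i j /andP[Ei ci] /andP[Ej cj].
  rewrite -ler_pdivrMl //.
  have -> : G^-1 * (i%:R - j%:R) = p i - p j.
    by rewrite /p; field; rewrite gt_eqF.
  apply: le_trans (ler_norm _) _.
  have ne : `|e| = 1 by apply/eqP; rewrite -sqr_norm_eq1 e2.
  have nE : `|p i - p j| * a = `|e * (p i - p j) * a|.
    by rewrite !normrM ne mul1r (gtr0_norm a0).
  rewrite ler_pdivlMr // nE.
  have -> : e * (p i - p j) * a = (v + a * tri (p i)) - (v + a * tri (p j)).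
    by rewrite !hc //; ring.
  apply: le_trans (ler_normB _ _) _; rewrite (_ : 2 * u = u + u); last by ring.
  exact: lerD.
have -> : \sum_(k < g.+1) (E k)%:R = \sum_(k < g.+1) (E k && c1 k)%:R +
    \sum_(k < g.+1) (E k && c2 k)%:R + \sum_(k < g.+1) (E k && c3 k)%:R +
    \sum_(k < g.+1) (E k && c4 k)%:R :> R.
  rewrite -!big_split /=; apply: eq_bigr => k _.
  case: (E k) => /=; last by rewrite !addr0.
  rewrite /c1 /c2 /c3 /c4.
  case: (ltP (p k) (m%:~R + 2^-1)) => k1 /=.
    rewrite [_ + 1 <= _]leNgt [X in ~~ X](_ : _ = true) /=; last by lra.
    by rewrite leNgt [X in ~~ X](_ : _ = true) /= ?addr0 //; lra.
  case: (ltP (p k) (m%:~R + 1)) => k2 /=.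
    by rewrite leNgt [X in ~~ X](_ : _ = true) /= ?addr0 ?add0r //; lra.
  by case: (ltP (p k) (m%:~R + 1 + 2^-1)) => k3 /=; rewrite ?addr0 ?add0r.
have e1 : (1 : R) ^+ 2 = 1 by rewrite expr1n.
have e2 : (-1 : R) ^+ 2 = 1 by rewrite sqrrN expr1n.
have s1 := step c1 1 (- m%:~R) e1.
have s2 := step c2 (-1) (m%:~R + 1) e2.
have s3 := step c3 1 (- (m%:~R + 1)) e1.
have s4 := step c4 (-1) (m%:~R + 2) e2.
have Gu : 1 <= G * (u / a).
  rewrite -ler_pdivrMl // mulr1; apply: le_trans gu _.
  by rewrite ler_pdivlMr // ler_piMr // ltW.
apply: (@le_trans _ _ (4 * (G * (2 * u / a) + 1))).
  rewrite (_ : 4 * _ = (G * (2 * u / a) + 1) + (G * (2 * u / a) + 1) +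
    (G * (2 * u / a) + 1) + (G * (2 * u / a) + 1)); last by ring.
  apply: lerD; [apply: lerD; [apply: lerD|]|].
  - apply: s1 => k kc; rewrite mul1r; apply: tri_low => //.
    by apply: le_trans m1 (pge k).
  - apply: s2 => k /andP[k1 k2]; rewrite mulN1r addrC; exact: tri_high.
  - apply: s3 => k /andP[k1 k2]; rewrite mul1r.
    by have := @tri_low (p k) (m + 1); rewrite intrD => ->.
  - apply: s4 => k k1; rewrite mulN1r addrC.
    have := @tri_high (p k) (m + 1); rewrite intrD => -> //.
    + by ring.
    + by have := plt k; lra.
rewrite (_ : 12 * u / a * G = 12 * (G * (u / a))); last by ring.
rewrite (_ : G * (2 * u / a) = 2 * (G * (u / a))); last by ring.
by move: (G * (u / a)) Gu => X; lra.
Qed.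

End Triangle.

Section Wave.
Variables (R : realType) (q g : nat).

(* The distance to the nearest integer keeps the wave bounded however many bumps overlap. *)
Definition wave (b : 'I_q -> R) (xi : {ffun 'I_q -> 'I_g.+1}) : R :=
  tri (\sum_(i < q) (xi i)%:R / g.+1%:R * b i).

(** Translating the coordinate [i0] in the cyclic group ['I_g.+1] permutes the choices, so the sum
    may be averaged over these translations. Since [bz i0 = 0], they leave [wave bz] fixed, while
    the argument of [wave bx] runs through a progression of step [1 / g.+1], as in [tri_count]. *)
Lemma wave_count (bx bz : 'I_q -> R) (i0 : 'I_q) (a u v : R) :
  bx i0 = 1 -> bz i0 = 0 -> 0 < a <= 1 -> (g.+1%:R)^-1 <= u ->
  \sum_(xi : {ffun 'I_q -> 'I_g.+1})
    (`| v + (a * wave bx xi - a * wave bz xi) | <= u)%R%:R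
    <= 12 * u / a * #|{ffun 'I_q -> 'I_g.+1}|%:R.
Proof.
move=> bx1 bz0 a01 gu.
pose F (xi : {ffun 'I_q -> 'I_g.+1}) : R :=
  (`| v + (a * wave bx xi - a * wave bz xi) | <= u)%R%:R.
pose sh (s : 'I_g.+1) (xi : {ffun 'I_q -> 'I_g.+1}) : {ffun 'I_q -> 'I_g.+1} :=
  [ffun i => if i == i0 then s + xi i else xi i].
have shI s : injective (sh s).
  move=> x y /ffunP xy; apply/ffunP => i; have := xy i.
  by rewrite !ffunE; case: eqP => // _ /addrI.
have G0 : 0 < g.+1%:R :> R by rewrite ltr0n.
rewrite -(ler_pM2l G0).
have -> : g.+1%:R * \sum_xi F xi = \sum_xi \sum_(s < g.+1) F (sh s xi).
  rewrite exchange_big /=.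
  have FE (s : 'I_g.+1) : \sum_xi F (sh s xi) = \sum_xi F xi.
    by rewrite [RHS](reindex_inj (shI s)).
  rewrite [RHS](eq_bigr (fun=> \sum_xi F xi)) => [|s _]; last exact: FE.
  by rewrite sumr_const card_ord mulr_natl.
apply: (@le_trans _ _ (\sum_(xi : {ffun 'I_q -> 'I_g.+1}) 12 * u / a * g.+1%:R)); last first.
  rewrite sumr_const -[leLHS]mulr_natr le_eqVlt; apply/orP; left; apply/eqP; ring.
apply: ler_sum => xi _.
pose C : R := \sum_(i < q | i != i0) (xi i)%:R / g.+1%:R * bx i.
have wx (s : 'I_g.+1) :
    wave bx (sh s xi) = tri (C + (nat_of_ord (s + xi i0)%R)%:R / g.+1%:R).
  rewrite /wave (bigD1 i0) //= !ffunE eqxx bx1 mulr1 addrC; congr (tri (_ + _)).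
  by apply: eq_bigr => i ii0; rewrite ffunE (negbTE ii0).
have wz (s : 'I_g.+1) : wave bz (sh s xi) = wave bz xi.
  rewrite /wave; congr tri; apply: eq_bigr => i _; rewrite ffunE.
  by case: eqP => // ->; rewrite bz0 !mulr0.
have Fsh (s : 'I_g.+1) : F (sh (s - xi i0) xi) =
    (`| (v - a * wave bz xi) + a * tri (C + s%:R / g.+1%:R) | <= u)%R%:R.
  rewrite /F wx wz subrK; congr ((`| _ | <= u)%R%:R); ring.
rewrite (reindex_inj (addIr (- xi i0))) /= (eq_bigr _ (fun s _ => Fsh s)).
exact: tri_count.
Qed.

(** The coordinates draw independent choices: the indicator factors, and the sum of products is a
    product of sums. *)
Lemma waves_count (d : nat) (bx bz : 'I_q -> R) (i0 : 'I_q) (a u : R) (v : 'I_d -> R) :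
  bx i0 = 1 -> bz i0 = 0 -> 0 < a <= 1 -> (g.+1%:R)^-1 <= u ->
  \sum_(xi : {ffun 'I_d -> {ffun 'I_q -> 'I_g.+1}})
    [forall l, `| v l + (a * wave bx (xi l) - a * wave bz (xi l)) | <= u]%:R
    <= (12 * u / a) ^+ d * #|{ffun 'I_d -> {ffun 'I_q -> 'I_g.+1}}|%:R.
Proof.
move=> bx1 bz0 a01 gu.
pose P (l : 'I_d) (xi : {ffun 'I_q -> 'I_g.+1}) : bool :=
  `| v l + (a * wave bx xi - a * wave bz xi) | <= u.
have -> : \sum_(xi : {ffun 'I_d -> {ffun 'I_q -> 'I_g.+1}})
    [forall l, P l (xi l)]%:R =
    \sum_(xi : {ffun 'I_d -> {ffun 'I_q -> 'I_g.+1}}) \prod_(l < d) (P l (xi l))%:R :> R.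
  apply: eq_bigr => xi _.
  case: (boolP [forall l, P l (xi l)]) => [/forallP h|].
    by rewrite big1 // => l _; rewrite h.
  rewrite negb_forall => /existsP[l Pl].
  by rewrite (bigD1 l) //= (negbTE Pl) mul0r.
rewrite -(bigA_distr_bigA (fun l xi => (P l xi)%:R : R)) /=.
rewrite card_ffun card_ord natrX -exprMn.
rewrite -[X in _ ^+ X](card_ord d) -prodr_const.
apply: ler_prod => l _; rewrite sumr_ge0 //=; exact: wave_count bx1 bz0 a01 gu.
Qed.

End Wave.

(** * Independent choices read off the digits of an integer *)

Section MixedRadix.
Variable (M : nat -> nat).

Fixpoint radix (N : nat) : nat := if N is N'.+1 then radix N' * M N' else 1.

Lemma radix_gt0 N : (forall n, 0 < M n)%N -> (0 < radix N)%N.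
Proof. by move=> M0; elim: N => //= N IH; rewrite muln_gt0 IH M0. Qed.

Lemma sum_radix (V : nmodType) N (G : nat -> nat -> V) : (0 < M N)%N ->
  \sum_(0 <= c < radix N.+1) G (c %/ M N)%N (c %% M N)%N =
  \sum_(0 <= c < radix N) \sum_(0 <= k < M N) G c k.
Proof.
move=> M0; rewrite /= big_nat_mul; apply: eq_bigr => c _.
rewrite mulSn addnC -{1}[(c * M N)%N]add0n big_addn addKn.
rewrite !big_nat; apply: eq_bigr => k /andP[_ kM].
by rewrite addnC divnMDl // divn_small // addn0 modnMDl modn_small.
Qed.

Variables (R : realType) (K : Type) (d : nat) (stage : nat -> nat -> K -> 'I_d -> R).

(** An integer below [radix N] encodes one choice for each stage below [N], the latest stage in the
    least significant digit; dividing by [M N'] forgets the latest choice only. *)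
Fixpoint partial (N c : nat) (x : K) (l : 'I_d) : R :=
  if N is N'.+1 then
    partial N' (c %/ M N') x l + stage N' (c %% M N') x l
  else 0.

(** All digits but that of stage [n] are frozen, and the contribution of the other stages is
    absorbed into [v]; this is why the hypothesis on stage [n] quantifies over every [v]. *)
Lemma partial_count n N x y (u p : R) : (forall n, 0 < M n)%N -> (n < N)%N ->
  (forall v : 'I_d -> R,
    \sum_(0 <= k < M n)
      [forall l, `| v l + (stage n k x l - stage n k y l) | <= u]%:R <= p * (M n)%:R) ->
  forall v : 'I_d -> R,
    \sum_(0 <= c < radix N)
      [forall l, `| v l + (partial N c x l - partial N c y l) | <= u]%:R
      <= p * (radix N)%:R.
Proof.
move=> M0 + hn; elim: N => // N IH nN v.
pose G c k : R := [forall l, `| v l + ((partial N c x l + stage N k x l) -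
  (partial N c y l + stage N k y l)) | <= u]%:R.
rewrite (sum_radix G) // natrM.
move: nN; rewrite ltnS leq_eqVlt => /orP[/eqP nN|/IH {}IH].
  subst n.
  apply: (@le_trans _ _ (\sum_(0 <= c < radix N) p * (M N)%:R)); last first.
    by rewrite sumr_const_nat subn0 -[leLHS]mulr_natr le_eqVlt; apply/orP; left; apply/eqP; ring.
  apply: ler_sum => c _.
  apply: le_trans (hn (fun l => v l + (partial N c x l - partial N c y l))).
  rewrite le_eqVlt; apply/orP; left; apply/eqP; apply: eq_bigr => k _.
  by rewrite /G; congr (_%:R); congr (nat_of_bool _); apply: eq_forallb => l; congr (`| _ | <= _); ring.
rewrite exchange_big /=.
apply: (@le_trans _ _ (\sum_(0 <= k < M N) p * (radix N)%:R)); last first.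
  by rewrite sumr_const_nat subn0 -[leLHS]mulr_natr le_eqVlt; apply/orP; left; apply/eqP; ring.
apply: ler_sum => k _.
apply: le_trans (IH (fun l => v l + (stage N k x l - stage N k y l))).
rewrite le_eqVlt; apply/orP; left; apply/eqP; apply: eq_bigr => c _.
by rewrite /G; congr (_%:R); congr (nat_of_bool _); apply: eq_forallb => l; congr (`| _ | <= _); ring.
Qed.

End MixedRadix.

(** * Compact metric spaces and continuous functions *)

Section Euclidean.
Variables (R : realType) (d : nat).
Implicit Types z : 'I_d -> R.

Lemma eucl_ge z i : `| z i | <= eucl z.
Proof.
rewrite -sqrtr_sqr /eucl ler_wsqrtr // (bigD1 i) //= lerDl.
by apply: sumr_ge0 => j _; exact: sqr_ge0.
Qed.

Lemma eucl_le z (c : R) : (forall i, `| z i | <= c) -> eucl z <= d%:R * c.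
Proof.
move=> zc; case: d z zc => [z _|d' z zc].
  by rewrite /eucl big_ord0 sqrtr0 mul0r.
have c0 : 0 <= c by exact: le_trans (normr_ge0 _) (zc ord0).
have dc0 : 0 <= d'.+1%:R * c by rewrite mulr_ge0.
rewrite -[leRHS]ger0_norm // -sqrtr_sqr /eucl ler_wsqrtr //.
apply: (@le_trans _ _ (\sum_(i < d'.+1) c ^+ 2)).
  by apply: ler_sum => i _; rewrite -real_normK ?num_real // lerXn2r ?nnegrE.
rewrite sumr_const card_ord -[leLHS]mulr_natl exprMn ler_wpM2r ?sqr_ge0 //.
by rewrite expr2 ler_peMl ?ler0n // ler1n.
Qed.

End Euclidean.

Section CompactMetric.
Variables (R : realType) (K : Type) (rho : K -> K -> R).
Hypotheses (rhoM : is_metric rho) (Kc : mcompact rho).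

Lemma metric_xx x : rho x x = 0. Proof. by case: rhoM => _ /(_ x x) h _ _; apply/h. Qed.
Lemma metricC x y : rho x y = rho y x. Proof. by case: rhoM. Qed.
Lemma metric_triangle y x z : rho x z <= rho x y + rho y z. Proof. by case: rhoM. Qed.

Lemma mopen_ball x r : mopen rho [set y | rho x y < r].
Proof.
move=> y /= xy; exists (r - rho x y) => [|z yz]; first by rewrite subr_gt0.
by have := metric_triangle y x z; lra.
Qed.

Lemma mcompact_nat (U : nat -> set K) : (forall n, mopen rho (U n)) ->
  (forall x, exists n, U n x) -> exists N, forall x, exists2 n, (n < N)%N & U n x.
Proof.
move=> Uo Uc; have [n [g gU]] := Kc Uo Uc.
exists (\max_(i < n) g i).+1 => x; have [j Uj] := gU x.
by exists (g j) => //; rewrite ltnS; exact: leq_bigmax.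
Qed.

Lemma finite_net r : 0 < r ->
  exists q (z : 'I_q -> K), forall x, exists i, rho (z i) x < r.
Proof.
move=> r0.
have [n [g gU]] := Kc (fun x => @mopen_ball x r)
  (fun x => ex_intro _ x (eq_ind_r (fun t => t < r) r0 (metric_xx x))).
by exists n, g.
Qed.

Lemma metric_bounded : exists2 D, 0 < D & forall x y, rho x y < D.
Proof.
have [x0|K0] := pselect (inhabited K); last first.
  by exists 1 => // x; case: K0; exists.
case: x0 => x0.
have [|x|N hN] := @mcompact_nat (fun n => [set y | rho x0 y < n%:R]).
- by move=> n; exact: mopen_ball.
- by exists (Num.truncn (rho x0 x)).+1; exact: truncnS_gt.
exists (2 * N.+1%:R) => [|x y]; first by rewrite mulr_gt0.
have b z : rho x0 z < N.+1%:R.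
  have [n nN /= h] := hN z; apply: lt_trans h _.
  by rewrite ltr_nat (leq_trans nN).
by have := metric_triangle x0 x y; rewrite (metricC x x0); have := b x; have := b y; lra.
Qed.

Section CK.
Variable d : nat.
Implicit Types f g h : K -> 'I_d -> R.

Lemma CKP f : CK rho f <-> forall x e, 0 < e ->
  exists2 del, 0 < del & forall y, rho x y < del -> forall i, `| f x i - f y i | < e.
Proof.
split=> fc x e e0.
  have [del del0 h] := fc x e e0; exists del => // y /h {}h i; apply: le_lt_trans h.
  exact: (eucl_ge (fun i => f x i - f y i)).
have e0' : 0 < e / d.+1%:R by rewrite divr_gt0.
have [del del0 h] := fc x _ e0'; exists del => // y /h xy.
apply: (@le_lt_trans _ _ (d%:R * (e / d.+1%:R))).
  by apply: eucl_le => i; apply/ltW.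
by rewrite mulrA ltr_pdivrMr // mulrC ltr_pM2l // ltr_nat.
Qed.

Lemma CK_cst0 : CK rho (fun _ (_ : 'I_d) => 0).
Proof. by apply/CKP => x e e0; exists 1 => // y _ i; rewrite subrr normr0. Qed.

Lemma CKD f g : CK rho f -> CK rho g -> CK rho (fun x i => f x i + g x i).
Proof.
move=> /CKP fc /CKP gc; apply/CKP => x e e0.
have e2 : 0 < e / 2 by rewrite divr_gt0.
have [d1 d10 h1] := fc x _ e2; have [d2 d20 h2] := gc x _ e2.
exists (Num.min d1 d2) => [|y]; first by rewrite lt_min d10.
rewrite lt_min => /andP[/h1 {}h1 /h2 {}h2] i.
rewrite opprD addrACA; apply: le_lt_trans (ler_normD _ _) _.
by have := h1 i; have := h2 i; lra.
Qed.

Lemma CKN f : CK rho f -> CK rho (fun x i => - f x i).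
Proof.
move=> /CKP fc; apply/CKP => x e /(fc x)[del d0 h]; exists del => // y /h {}h i.
by rewrite -opprD normrN.
Qed.

Lemma CK_bounded f : CK rho f -> exists2 c, 0 < c & forall x i, `| f x i | <= c.
Proof.
move=> /CKP fc.
pose U n := [set x | exists2 e, 0 < e & forall i, `| f x i | + e < n%:R].
have [|x|N hN] := @mcompact_nat U.
- move=> n x [e e0 h]; have e2 : 0 < e / 2 by rewrite divr_gt0.
  have [del del0 hd] := fc x _ e2; exists del => // y /hd {}hd.
  exists (e / 2) => // i; have := h i; have := hd i => h1 h2.
  have : `|f y i| <= `|f x i| + `|f x i - f y i|.
    by rewrite -{1}[f y i](subKr (f x i)); exact: ler_normB.
  lra.
- exists (Num.truncn (\sum_i `|f x i| + 1)).+1, 2^-1 => [//|i].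
  have h : `|f x i| <= \sum_i `|f x i|.
    by rewrite (bigD1 i) //= lerDl; apply: sumr_ge0.
  by apply: le_lt_trans (truncnS_gt (\sum_i `|f x i| + 1)); lra.
exists N.+1%:R => [//|x i]; have [n nN [e e0 h]] := hN x.
have : n%:R <= N.+1%:R :> R by rewrite ler_nat ltnW // (leq_trans nN).
by have := h i; lra.
Qed.

Lemma supdist_ge f g x i : CK rho f -> CK rho g -> `| f x i - g x i | <= supdist f g.
Proof.
move=> /CKN fc gc; have [c c0 h] := CK_bounded (CKD gc fc).
apply: le_trans (eucl_ge (fun i => f x i - g x i) i) _.
apply: ub_le_sup; last by exists x.
exists (d%:R * c) => _ [y _ <-]; apply: eucl_le => j.
by rewrite distrC; exact: h.
Qed.

Lemma supdist_le f g c (x0 : K) : (forall x i, `| f x i - g x i | <= c) ->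
  supdist f g <= d%:R * c.
Proof.
move=> h; apply: ge_sup; first by exists (eucl (fun i => f x0 i - g x0 i)), x0.
by move=> _ [y _ <-]; apply: eucl_le => j.
Qed.

End CK.
End CompactMetric.

(** * The law of a uniform limit of simple functions on [0, 1[ *)

Section UnitInterval.
Variable R : realType.
Local Notation leb := (@lebesgue_measure R).

Lemma nondecreasing_union_le (A : (set R)^nat) (C : \bar R) N0 :
  (forall n, measurable (A n)) -> (forall n, A n `<=` A n.+1) ->
  (forall n, (N0 <= n)%N -> (leb (A n) <= C)%E) -> (leb (\bigcup_n A n) <= C)%E.
Proof.
move=> mA ndA hC.
have nd : {homo A : n m / (n <= m)%N >-> (n <= m)%O}.
  by apply: homo_leq => [?|? ? ?|n]; [exact: lexx|exact: le_trans|exact/subsetPset].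
have cv := @nondecreasing_cvg_mu _ _ _ leb A mA (bigcupT_measurable _ mA) nd.
rewrite -(cvg_lim _ cv) //; apply: lime_le; first by apply/cvg_ex; eexists; exact: cv.
by exists N0 => // n /= /hC.
Qed.

Variable M : nat -> nat.
Hypothesis M0 : forall n, (0 < M n)%N.

Definition digits (N : nat) (w : R) : nat := Num.truncn ((radix M N)%:R * w).

(** The intervals of length [1 / radix N.+1] refine those of length [1 / radix N], so one point [w]
    makes coherent choices at all levels. *)
Lemma digits_div N w : 0 <= w -> (digits N.+1 w %/ M N)%N = digits N w.
Proof.
move=> w0; apply/esym/truncn_def; rewrite /digits /=; set k := Num.truncn _.
have /andP[k1 k2] : k%:R <= (radix M N * M N)%:R * w < k.+1%:R.
  by apply: truncn_itv; rewrite mulr_ge0.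
have m0 : 0 < (M N)%:R :> R by rewrite ltr0n.
apply/andP; split; rewrite -(ler_pM2r m0, ltr_pM2r m0) mulrAC -!natrM.
  by apply: le_trans k1; rewrite ler_nat leq_divM.
by apply: lt_le_trans k2 _; rewrite ler_nat ltn_ceil.
Qed.

Definition cyl N (Q : pred nat) : set R := `[0, 1[ `&` [set w | Q (digits N w)].

Lemma cylE N Q : cyl N Q = \big[setU/set0]_(c < radix M N)
  (if Q c then `[c%:R / (radix M N)%:R, c.+1%:R / (radix M N)%:R[%classic else set0).
Proof.
set P := radix M N.
have P0 : 0 < P%:R :> R by rewrite ltr0n radix_gt0.
rewrite -(bigcup_mkord P (fun c => if Q c then `[c%:R / P%:R, c.+1%:R / P%:R[%classic else set0)).
apply/seteqP; split => w.
  move=> [] /=; rewrite in_itv /= => /andP[w0 w1] Qw; exists (digits N w).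
    rewrite /= /digits truncn_lt_nat ?mulr_ge0 // -[ltRHS]mulr1 ltr_pM2l //.
  rewrite Qw /= in_itv /= ler_pdivrMr // ltr_pdivlMr //.
  by rewrite mulrC; apply: truncn_itv; rewrite mulr_ge0.
move=> [c /= cP]; case: ifPn => // Qc; rewrite /= in_itv /= => /andP[].
rewrite ler_pdivrMr // ltr_pdivlMr // mulrC => c1 c2; split.
  rewrite /= in_itv /=; apply/andP; split.
    by rewrite -(pmulr_rge0 _ P0); apply: le_trans c1.
  by rewrite -(ltr_pM2l P0) mulr1; apply: lt_le_trans c2 _; rewrite ler_nat.
by rewrite /= /digits (@truncn_def _ _ c) ?Qc // c1.
Qed.

Lemma measurable_cyl N Q : measurable (cyl N Q).
Proof. by rewrite cylE; apply: bigsetU_measurable => c _; case: ifP. Qed.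

Lemma leb_cyl_le N Q :
  (leb (cyl N Q) <= ((\sum_(0 <= c < radix M N) (Q c)%:R) / (radix M N)%:R)%:E)%E.
Proof.
rewrite cylE; set P := radix M N.
have P0 : 0 < P%:R :> R by rewrite ltr0n radix_gt0.
apply: le_trans.
  apply: (Boole_inequality leb
    (A := fun c => if Q c then `[c%:R / P%:R, c.+1%:R / P%:R[%classic else set0)).
  by move=> c _; case: ifP.
rewrite big_mkord mulr_suml -sumEFin; apply: lee_sum => c _; case: ifP => _.
  apply: (@le_trans _ _ (leb `[c%:R / P%:R, c.+1%:R / P%:R[)); first exact: lexx.
  rewrite lebesgue_measure_itv /= lte_fin ltr_pM2r ?invr_gt0 // ltr_nat ltnSn.
  by rewrite -EFinB lee_fin -mulrBl -natrB // subSnn.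
by rewrite measure0 mul0r.
Qed.

End UnitInterval.

Section RandomLimit.
Variables (R : realType) (K : Type) (rho : K -> K -> R) (d : nat).
Variables (x0 : K) (M : nat -> nat) (Phi : nat -> nat -> K -> 'I_d -> R).
Hypothesis M0 : forall n, (0 < M n)%N.
Hypothesis PhiC : forall N c, CK rho (Phi N c).
Hypothesis PhiS : forall N c x l,
  `| Phi N.+1 c x l - Phi N (c %/ M N)%N x l | <= N.+1%:R^-1 - N.+2%:R^-1.
Local Notation leb := (@lebesgue_measure R).
Local Notation digits := (digits M).

Definition sample N (w : R) : K -> 'I_d -> R := Phi N (digits N w).

(** By [PhiS] the sequence [sample n w x l - n.+1%:R^-1] is nondecreasing when [0 <= w], so that its
    supremum is the limit of the samples. *)
Definition limit (w : R) (x : K) (l : 'I_d) : R :=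
  sup [set sample n w x l - n.+1%:R^-1 | n in [set: nat]].

Lemma sample_step N w x l : 0 <= w ->
  `| sample N.+1 w x l - sample N w x l | <= N.+1%:R^-1 - N.+2%:R^-1.
Proof. by move=> w0; rewrite /sample -(digits_div M0 N w0); exact: PhiS. Qed.

Lemma sample_close m N w x l : 0 <= w -> (N <= m)%N ->
  `| sample m w x l - sample N w x l | <= N.+1%:R^-1 - m.+1%:R^-1.
Proof.
move=> w0 /subnK <-; elim: (m - N)%N => [|k IH].
  by rewrite add0n !subrr normr0.
have h := sample_step (k + N) x l w0; rewrite addSn.
move: IH h.
move: (N.+1%:R^-1 : R) ((k + N).+1%:R^-1 : R) ((k + N).+2%:R^-1 : R) => p q r.
rewrite !ler_norml => /andP[? ?] /andP[? ?]; apply/andP; split; lra.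
Qed.

Lemma limit_close N w x l : 0 <= w -> `| limit w x l - sample N w x l | <= N.+1%:R^-1.
Proof.
move=> w0; pose E := [set sample n w x l - n.+1%:R^-1 | n in [set: nat]].
have E_ub n m : sample n w x l - n.+1%:R^-1 <= sample m w x l + m.+1%:R^-1.
  have i0 (j : nat) : 0 < j.+1%:R^-1 :> R by rewrite invr_gt0.
  have := i0 n; have := i0 m.
  case: (leqP n m) => [nm|/ltnW mn].
    have := sample_close x l w0 nm; rewrite ler_norml => /andP[].
    by move: (n.+1%:R^-1 : R) (m.+1%:R^-1 : R) => p r; lra.
  have := sample_close x l w0 mn; rewrite ler_norml => /andP[].
  by move: (n.+1%:R^-1 : R) (m.+1%:R^-1 : R) => p r; lra.
have E0 : E !=set0 by exists (sample 0 w x l - 1%:R^-1), 0%N.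
have up : limit w x l <= sample N w x l + N.+1%:R^-1.
  by apply: ge_sup => // _ [n _ <-].
have lo : sample N w x l - N.+1%:R^-1 <= limit w x l.
  apply: ub_le_sup; last by exists N.
  by exists (sample N w x l + N.+1%:R^-1) => _ [n _ <-].
move: up lo; move: (N.+1%:R^-1 : R) (limit w x l) => p r up lo.
by rewrite ler_norml; apply/andP; split; lra.
Qed.

Lemma inv_small (e : R) : 0 < e -> exists N, N.+1%:R^-1 < e.
Proof.
move=> e0; exists (Num.truncn e^-1).
by rewrite -[ltRHS]invrK ltf_pV2 ?posrE ?invr_gt0 // truncnS_gt.
Qed.

Lemma limitC w : 0 <= w -> CK rho (limit w).
Proof.
move=> w0; apply/CKP => x e e0.
have e3 : 0 < e / 3 by rewrite divr_gt0.
have [N hN] := inv_small e3.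
have [del d0 h] := (CKP rho _).1 (PhiC N (digits N w)) x _ e3.
exists del => // y /h {}h i; have := h i.
have := limit_close N x i w0; have := limit_close N y i w0; rewrite /sample.
move: (N.+1%:R^-1 : R) hN => p hN.
rewrite !ler_norml !ltr_norml => /andP[? ?] /andP[? ?] /andP[? ?].
apply/andP; split; lra.
Qed.

(* [2 / N.+1] is twice the distance from [sample N] to [limit]: this makes membership of
   [sample N w] increasing in [N]. *)
Definition deep (U : set (K -> 'I_d -> R)) N : set (K -> 'I_d -> R) :=
  [set f | CK rho f /\ forall h, CK rho h ->
    (forall x l, `| f x l - h x l | <= 2 / N.+1%:R) -> U h].

Lemma deep_sub U N : deep U N `<=` U.
Proof.
by move=> f [fC]; apply => // x l; rewrite subrr normr0 divr_ge0.
Qed.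

Definition deep_cyl U N : set R := cyl M N (fun c => `[< deep U N (Phi N c) >]).

Lemma deep_cyl_nd U N : deep_cyl U N `<=` deep_cyl U N.+1.
Proof.
move=> w [w01 /asboolP [_ h]]; split=> //; apply/asboolP; split=> // k kC hk.
have w0 : 0 <= w by move: w01; rewrite /= in_itv => /andP[].
apply: h => // x l.
have := hk x l; have := sample_step N x l w0; rewrite /sample.
have : N.+2%:R^-1 <= N.+1%:R^-1 :> R by rewrite lef_pV2 ?posrE // ler_nat.
move: (N.+1%:R^-1 : R) (N.+2%:R^-1 : R) => p r.
rewrite !ler_norml => ? /andP[? ?] /andP[? ?]; apply/andP; split; lra.
Qed.

(** Membership of the limit in an open set is settled at a finite level. This gives both the
    measurability of [limit] and bounds on its law by counting digits. *)
Lemma limit_preimage U : CK_open rho U ->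
  `[0, 1[ `&` limit @^-1` U = \bigcup_N deep_cyl U N.
Proof.
move=> [UC Uo]; apply/seteqP; split => [w [w01 /= Uw]|w [N _ [w01 /asboolP [_ h]]]].
  have w0 : 0 <= w by move: w01; rewrite /= in_itv => /andP[].
  have [e e0 he] := Uo _ Uw.
  (* The 3 adds the margin [2 / N.+1] of [deep] to the distance [1 / N.+1] from the sample to the
     limit; a factor [d] is lost in passing from coordinates to [supdist]. *)
  have e3 : 0 < e / (3 * d.+1%:R) by rewrite divr_gt0 // mulr_gt0.
  have [N hN] := inv_small e3; exists N => //; split => //.
  apply/asboolP; split=> // h hC hk; apply: he => //.
  apply: (@le_lt_trans _ _ (d%:R * (3 * N.+1%:R^-1))).
    apply: supdist_le => // x l.
    have := limit_close N x l w0; have := hk x l; rewrite /sample.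
    move: (N.+1%:R^-1 : R) => p.
    rewrite !ler_norml => /andP[? ?] /andP[? ?]; apply/andP; split; lra.
  apply: (@le_lt_trans _ _ (d.+1%:R * (3 * N.+1%:R^-1))).
    by rewrite ler_wpM2r ?mulr_ge0 // ler_nat.
  move: hN; rewrite ltr_pdivlMr ?mulr_gt0 //; apply: le_lt_trans.
  by rewrite le_eqVlt; apply/orP; left; apply/eqP; ring.
have w0 : 0 <= w by move: w01; rewrite /= in_itv => /andP[].
split=> //=; apply: h; first exact: limitC.
move=> x l; have := limit_close N x l w0; rewrite distrC => /le_trans; apply.
by rewrite -[leLHS]mul1r ler_wpM2r // ler1n.
Qed.

Definition limit_law (A : set (K -> 'I_d -> R)) : \bar R :=
  leb (`[0, 1[ `&` limit @^-1` A).

Lemma measurable_preimage A : CK_borel rho A ->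
  measurable (`[0, 1[ `&` limit @^-1` A : set R).
Proof.
apply: (@smallest_sub _ _ _ [set A | measurable (`[0, 1[ `&` limit @^-1` A : set R)]).
  split => /= [|B mB|F mF].
  - by rewrite preimage_set0 setI0.
  - rewrite (_ : _ `&` _ = `[0, 1[ `\` (`[0, 1[ `&` limit @^-1` B)).
      by apply: measurableD.
    apply/seteqP; split => w /= [w01 h]; split=> //.
      by move=> [_ Bw]; apply: h.2.
    by split; [apply: limitC; move: w01; rewrite in_itv => /andP[]|move=> Bw; apply: h].
  - by rewrite preimage_bigcup setI_bigcupr; apply: bigcupT_measurable.
move=> U Uo /=; rewrite limit_preimage //.
by apply: bigcupT_measurable => N; apply: measurable_cyl.
Qed.

Lemma limit_law_prob : CK_borel_prob rho limit_law.
Proof.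
split=> [|A mA|F mF tF|].
- by rewrite /limit_law preimage_set0 setI0 measure0.
- exact: measure_ge0.
- rewrite /limit_law preimage_bigcup setI_bigcupr.
  apply: (@measure_semi_sigma_additive _ _ _ leb).
  + by move=> n; apply: measurable_preimage.
  + apply/trivIsetP => i j _ _ ij; apply/seteqP; split => // w [[_ /= wi] [_ /= wj]].
    have : (F i `&` F j) (limit w) by split.
    by move/trivIsetP : tF => ->.
  + by apply: bigcupT_measurable => n; apply: measurable_preimage.
- rewrite /limit_law (_ : _ `&` _ = `[0%R, 1%R[%classic); last first.
    apply/seteqP; split => w [] //= w01; split=> //.
    by apply: limitC; move: w01 => /andP[].
  by rewrite lebesgue_measure_itv /= lte_fin ltr01 -EFinB subr0.
Qed.

Lemma limit_law_open_le U (C : R) N0 : CK_open rho U ->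
  (forall N, (N0 <= N)%N ->
    \sum_(0 <= c < radix M N) `[< U (Phi N c) >]%:R <= C * (radix M N)%:R) ->
  (limit_law U <= C%:E)%E.
Proof.
move=> Uo h; rewrite /limit_law limit_preimage //.
apply: (@nondecreasing_union_le _ _ _ N0).
- by move=> n; apply: measurable_cyl.
- by move=> n; apply: deep_cyl_nd.
- move=> N /h {}h; apply: (le_trans (leb_cyl_le R M0 N _)).
  rewrite lee_fin ler_pdivrMr; last by rewrite ltr0n radix_gt0.
  apply: le_trans h; apply: ler_sum => c _; rewrite ler_nat.
  by case: asboolP => // /deep_sub Uc; case: asboolP.
Qed.

(** For fixed [q] and [e], one [k] serves all [J], so continuity from below carries the bound [e] to
    the union over [J], even though the level [N0] depends on [J]. *)
Lemma limit_law_null (A : nat -> nat -> nat -> set (K -> 'I_d -> R)) :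
  (forall q k J, CK_open rho (A q k J)) ->
  (forall q k J, A q k J `<=` A q k J.+1) ->
  (forall q (e : R), 0 < e -> exists k, forall J, exists N0, forall N, (N0 <= N)%N ->
    \sum_(0 <= c < radix M N) `[< A q k J (Phi N c) >]%:R <= e * (radix M N)%:R) ->
  limit_law (\bigcup_q \bigcap_k \bigcup_J A q k J) = 0%E.
Proof.
move=> Ao And Asmall.
pose B q k : set R := \bigcup_J (`[0, 1[ `&` limit @^-1` (A q k J)).
have mO q k J : measurable (`[0, 1[ `&` limit @^-1` (A q k J) : set R).
  by apply: measurable_preimage; apply: sub_gen_smallest.
have mB q k : measurable (B q k) by apply: bigcupT_measurable.
have mI q : measurable (\bigcap_k B q k) by apply: bigcapT_measurable.
have -> : limit_law (\bigcup_q \bigcap_k \bigcup_J A q k J) = leb (\bigcup_q \bigcap_k B q k).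
  congr leb; apply/seteqP; split => w.
    by move=> [w01 [q _ h]]; exists q => // k _; have [J _ hJ] := h k I; exists J.
  move=> [q _ h]; have [J _ [w01 _]] := h 0%N I; split => //; exists q => // k _.
  by have [J' _ [_ hJ']] := h k I; exists J'.
have nul q : leb (\bigcap_k B q k) = 0%E.
  apply/eqP; rewrite eq_le measure_ge0 andbT; apply/lee_addgt0Pr => e e0.
  rewrite add0e; have [k hk] := Asmall q e e0.
  apply: (@le_trans _ _ (leb (B q k))).
    have sI : \bigcap_k B q k `<=` B q k by move=> w; apply.
    by apply: le_measure => //; apply/mem_set; [exact: mI|exact: mB].
  apply: (@nondecreasing_union_le _ _ _ 0) => // [J w [w01 h]|J _].
    by split => //; apply: And.
  by have [N0 hN] := hk J; apply: (@limit_law_open_le _ _ N0).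
apply/eqP; rewrite eq_le measure_ge0 andbT.
apply: le_trans (generalized_Boole_inequality leb mI (bigcupT_measurable _ mI)) _.
by rewrite eseries0 // => q _ _; exact: nul.
Qed.

End RandomLimit.

(** * Thin covers of a graph and energies *)

Section Energy.
Variables (R : realType) (K : Type) (rho : K -> K -> R) (d : nat) (D : R).
Hypothesis D0 : 0 < D.

Definition dyad (j : nat) : R := D / 2 ^+ j.

Lemma dyad_gt0 j : 0 < dyad j.
Proof. by rewrite divr_gt0 // exprn_gt0. Qed.

Lemma dyadS j : dyad j.+1 = dyad j / 2.
Proof. by rewrite /dyad exprS invfM mulrA mulrAC. Qed.

Lemma dyad_le i j : (dyad i <= dyad j) = (j <= i)%N.
Proof.
rewrite ler_pM2l // lef_pV2 ?posrE ?exprn_gt0 //.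
by rewrite ler_eXn2l // ltr1n.
Qed.

(* The slack [eta] makes this condition open in [f]. *)
Definition thin (s eps : R) (J : nat) (f : K -> 'I_d -> R) : Prop :=
  exists n (V : 'I_n -> set K) (j : 'I_n -> nat) (eta : R),
  [/\ 0 < eta, forall x, exists i, V i x,
      forall i, (j i <= J)%N,
      forall i x y, V i x -> V i y -> rho x y <= dyad (j i) /\
        forall l, `| f x l - f y l | + eta <= dyad (j i) &
      \sum_i (dyad (j i)) `^ s < eps].

Lemma thin_leS s eps J f : thin s eps J f -> thin s eps J.+1 f.
Proof.
by move=> [n [V [j [eta [? ? h ? ?]]]]]; exists n, V, j, eta; split=> // i; apply/leqW.
Qed.

Definition close (f : K -> 'I_d -> R) (u : R) (x y : K) : bool :=
  (rho x y <= u) && [forall l, `| f x l - f y l | <= u].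

(** A discrete [s]-energy of the measure with mass [p a] at the point of the graph above [z a]: for
    [s > 0] the inner sum is comparable to the distance to the power [- s], cut off at scale
    [dyad J]. *)
Definition energy (s : R) (J m : nat) (p : 'I_m -> R) (z : 'I_m -> K) f : R :=
  \sum_a \sum_b p a * p b *
    \sum_(j < J.+1) (dyad j) `^ (- s) * (close f (dyad j) (z a) (z b))%:R.

Lemma energy_ge0 s J m (p : 'I_m -> R) (z : 'I_m -> K) f :
  (forall a, 0 <= p a) -> 0 <= energy s J p z f.
Proof.
move=> p0; apply: sumr_ge0 => a _; apply: sumr_ge0 => b _.
by rewrite !mulr_ge0 // sumr_ge0 // => k _; rewrite mulr_ge0 ?powR_ge0.
Qed.

(* Distribute the mass over the pieces of the cover: by AM-GM, total mass one forces
   a large diagonal contribution to the energy. *)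
Lemma thin_energy s eps J f m (p : 'I_m -> R) (z : 'I_m -> K) :
  0 < eps -> (forall a, 0 <= p a) -> \sum_a p a = 1 -> thin s eps J f ->
  1 <= eps * energy s J p z f.
Proof.
move=> eps0 p0 p1 [n [V [j [eta [eta0 Vc jJ Vd Vs]]]]].
have /choice[i hi] : forall a, exists i, V i (z a) by move=> a; exact: Vc.
pose q k := \sum_(a | i a == k) p a.
have q1 : \sum_k q k = 1.
  by rewrite -p1 (partition_big i xpredT).
pose w k := (dyad (j k)) `^ s.
have w0 k : 0 < w k by rewrite powR_gt0 // dyad_gt0.
pose E' := \sum_k (w k)^-1 * q k ^+ 2.
(* Two atoms assigned to the same piece are close at the scale of that piece, so a single term of
   the kernel is already [(w k)^-1]. *)
have E'E : E' <= energy s J p z f.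
  have -> : E' = \sum_a \sum_(b | i b == i a) p a * p b * (w (i a))^-1.
    rewrite (partition_big i xpredT) //=; apply: eq_bigr => k _.
    under [RHS]eq_bigr => a /eqP ak.
      rewrite ak -mulr_suml -mulr_sumr; over.
    by rewrite -!mulr_suml mulrC expr2.
  apply: ler_sum => a _; rewrite big_mkcond /=; apply: ler_sum => b _.
  have S0 : 0 <= \sum_(j < J.+1) (dyad j) `^ (- s) * (close f (dyad j) (z a) (z b))%:R.
    by apply: sumr_ge0 => k _; rewrite mulr_ge0 ?powR_ge0.
  case: eqP => [ba|_]; last by rewrite !mulr_ge0.
  rewrite ler_wpM2l ?mulr_ge0 //.
  have jl : (j (i a) < J.+1)%N by rewrite ltnS.
  have cl : close f (dyad (j (i a))) (z a) (z b).
    have hb := hi b; rewrite ba in hb.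
    have [h1 h2] := Vd _ _ _ (hi a) hb.
    rewrite /close h1 /=; apply/forallP => l; have := h2 l; lra.
  rewrite (bigD1 (Ordinal jl)) //= cl mulr1 powRN lerDl.
  by apply: sumr_ge0 => k _; rewrite mulr_ge0 ?powR_ge0.
apply: (@le_trans _ _ (eps * E')); last by rewrite ler_pM2l.
have amgm k : 2 * q k <= eps^-1 * w k + eps * ((w k)^-1 * q k ^+ 2).
  rewrite -subr_ge0.
  have -> : eps^-1 * w k + eps * ((w k)^-1 * q k ^+ 2) - 2 * q k =
     (w k - eps * q k) ^+ 2 / (eps * w k).
    by field; rewrite !gt_eqF.
  by rewrite divr_ge0 ?sqr_ge0 // ltW // mulr_gt0.
have : \sum_k 2 * q k <= \sum_k (eps^-1 * w k + eps * ((w k)^-1 * q k ^+ 2)).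
  by apply: ler_sum => k _.
rewrite big_split /= -!mulr_sumr q1 -/E' mulr1 => h.
have : eps^-1 * \sum_k w k <= 1.
  by rewrite mulrC ler_pdivrMr // mul1r ltW.
lra.
Qed.

(** Markov's inequality: [thin_energy] bounds the indicator by [eps] times the energy. *)
Lemma thin_count s eps J (I : Type) (r : seq I) (h : I -> K -> 'I_d -> R) (C : R)
    m (p : 'I_m -> R) (z : 'I_m -> K) :
  0 < eps -> (forall a, 0 <= p a) -> \sum_a p a = 1 ->
  \sum_(c <- r) energy s J p z (h c) <= C ->
  \sum_(c <- r) (`[< thin s eps J (h c) >]%:R : R) <= eps * C.
Proof.
move=> eps0 p0 p1 hC; apply: (@le_trans _ _ (eps * \sum_(c <- r) energy s J p z (h c))).
  rewrite mulr_sumr; apply: ler_sum => c _; case: asboolP => [th|_].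
    exact: thin_energy th.
  by apply: mulr_ge0; [exact: ltW|exact: energy_ge0].
by rewrite ler_pM2l.
Qed.

End Energy.

(** * The random function *)

Section RandomWaves.
Variables (R : realType) (K : Type) (rho : K -> K -> R) (d : nat) (D : R).
Variables (lev q g : nat -> nat) (psi : forall n, 'I_(q n) -> K -> R).
Hypothesis D0 : 0 < D.
Hypothesis rhoD : forall x y, rho x y < D.
Hypothesis lev0 : lev 0 = 0%N.
Hypothesis psiC : forall n i x e, 0 < e -> exists2 del, 0 < del &
  forall y, rho x y < del -> `| @psi n i x - psi i y | < e.
Hypothesis psi_sep : forall n x y, dyad D (lev n.+1) <= rho x y ->
  exists i, @psi n i x = 1 /\ psi i y = 0.
Hypothesis g_small : forall n, (g n).+1%:R^-1 <= dyad D (lev n.+1).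

(* Telescoping: the amplitudes from [N] on add up to [N.+1%:R^-1]. *)
Definition amp (n : nat) : R := n.+1%:R^-1 - n.+2%:R^-1.

Lemma amp_itv n : 0 < amp n <= 1.
Proof.
rewrite subr_gt0 ltf_pV2 ?posrE // ltr_nat ltnSn /=.
rewrite lerBlDr; apply: (@le_trans _ _ 1).
  by rewrite invf_le1 // ler1n.
by rewrite lerDl.
Qed.

Notation choices n := {ffun 'I_d -> {ffun 'I_(q n) -> 'I_(g n).+1}}.

Definition choices_card (n : nat) : nat := #|{: choices n}|.

Lemma choices_card_gt0 n : (0 < choices_card n)%N.
Proof. by apply/card_gt0P; exists [ffun=> [ffun=> ord0]]. Qed.

Definition choice_nth n k : choices n := nth [ffun=> [ffun=> ord0]] (enum {: choices n}) k.

Definition stage n k x l : R := amp n * wave (fun i => @psi n i x) (choice_nth n k l).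

Definition walk : nat -> nat -> K -> 'I_d -> R := partial choices_card stage.

Notation rdx N := (radix choices_card N).

Lemma walk_step N c x l :
  `| walk N.+1 c x l - walk N (c %/ choices_card N)%N x l | <= amp N.
Proof.
rewrite /walk /= addrAC subrr add0r /stage /wave.
have /andP[a0 _] := amp_itv N; set t := \sum_(_ < _) _.
have /andP[t0 t1] := tri_bound t.
rewrite ger0_norm; last by rewrite mulr_ge0 // ltW.
by rewrite ler_piMr ?(ltW a0) //; lra.
Qed.

Lemma stageC n k : CK rho (stage n k).
Proof.
apply/CKP => x e e0.
have e0' : 0 < e / (q n).+1%:R by rewrite divr_gt0.
have /choice[del hdel] : forall i, exists del, 0 < del /\
    forall y, rho x y < del -> `| @psi n i x - psi i y | < e / (q n).+1%:R.
  by move=> i; have [del del0 h] := psiC i x e0'; exists del.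
exists (\big[Num.min/1]_i del i).
  by apply: lt_bigmin => // i _; have [] := hdel i.
move=> y xy l.
have hi i : `| @psi n i x - psi i y | < e / (q n).+1%:R.
  by have [_] := hdel i; apply; apply: lt_le_trans xy (bigmin_le _ _ _).
rewrite /stage -mulrBr normrM.
have /andP[a0 a1] := amp_itv n; rewrite (gtr0_norm a0).
apply: (@le_lt_trans _ _ `| wave (fun i => @psi n i x) (choice_nth n k l) -
   wave (fun i => @psi n i y) (choice_nth n k l) |); first by rewrite ler_piMl.
apply: le_lt_trans (tri_lip _ _) _.
rewrite -sumrB; apply: le_lt_trans (ler_norm_sum _ _ _) _.
apply: (@le_lt_trans _ _ (\sum_(i < q n) e / (q n).+1%:R)).
  apply: ler_sum => i _; rewrite -mulrBr normrM; apply: le_trans (ltW (hi i)).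
  rewrite ler_piMl // ger0_norm ?divr_ge0 // ler_pdivrMr // mul1r ler_nat.
  exact: ltnW.
rewrite sumr_const card_ord -[ltLHS]mulr_natr -mulrA gtr_pMr // mulrC.
by rewrite ltr_pdivrMr // mul1r ltr_nat.
Qed.

Lemma walkC N c : CK rho (walk N c).
Proof.
elim: N c => [|N IH] c; first exact: CK_cst0.
exact: CKD (IH _) (stageC _ _).
Qed.

Lemma walk_count n N x y (u : R) (v : 'I_d -> R) :
  (n < N)%N -> dyad D (lev n.+1) <= rho x y -> dyad D (lev n.+1) <= u ->
  \sum_(0 <= c < rdx N) [forall l, `| v l + (walk N c x l - walk N c y l) | <= u]%:R
    <= (12 * u / amp n) ^+ d * (rdx N)%:R.
Proof.
move=> nN /psi_sep[i [px py]] hu.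
apply: (partial_count choices_card_gt0 nN) => {}v.
have := @waves_count R (q n) (g n) d (fun i => @psi n i x) (fun i => @psi n i y) i
  (amp n) u v px py (amp_itv n) (le_trans (g_small n) hu).
apply: le_trans; rewrite -[in leRHS]big_enum /= (big_nth [ffun=> [ffun=> ord0]]) -cardE.
by rewrite le_eqVlt; apply/orP; left; apply/eqP.
Qed.

(* [kappa s m] bounds the expected contribution to the [s]-energy of the graph of a pair of
   points of [K] at distance between [dyad D (lev m.+1)] and [dyad D (lev m)]. *)
Definition kappa (s : R) (m : nat) : R :=
  (12 / amp m) ^+ d * \sum_(j < (lev m.+1).+1) dyad D j ^+ d * (dyad D j) `^ (- s).

(** Adding all layers that contain the pair, instead of keeping only the last, makes potentials
    weighted sums of masses of balls. *)
Definition kernel s N x y : R := \sum_(m < N.+1) kappa s m * (rho x y < dyad D (lev m))%R%:R.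

Lemma kappa_ge0 s m : 0 <= kappa s m.
Proof.
have /andP[a0 _] := amp_itv m.
apply: mulr_ge0; first by rewrite exprn_ge0 // divr_ge0 // ltW.
apply: sumr_ge0 => j _.
by rewrite mulr_ge0 ?powR_ge0 // exprn_ge0 // ltW // dyad_gt0.
Qed.

Lemma kernel_ge s N m x y : (m <= N)%N -> rho x y < dyad D (lev m) ->
  kappa s m <= kernel s N x y.
Proof.
rewrite -ltnS => mN xy; rewrite /kernel (bigD1 (Ordinal mN)) //= xy mulr1 lerDl.
by apply: sumr_ge0 => i _; rewrite mulr_ge0 ?kappa_ge0.
Qed.

(** If [rho x y < dyad D (lev N)], no stage below [N] is known to separate the points; closeness is
    bounded by 1 at every scale and the hypothesis on [kappa s N] pays. Otherwise stage [m], with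
    [rho x y] between [dyad D (lev m.+1)] and [dyad D (lev m)], separates them and [walk_count]
    bounds each scale. *)
Lemma close_count s N J x y (v : K -> 'I_d -> R) :
  \sum_(j < J.+1) (dyad D j) `^ (- s) <= kappa s N ->
  \sum_(0 <= c < rdx N) \sum_(j < J.+1) (dyad D j) `^ (- s) *
    (close rho (fun x l => walk N c x l + v x l) (dyad D j) x y)%:R
  <= kernel s N x y * (rdx N)%:R.
Proof.
move=> JN; have [xy|xy] := ltP (rho x y) (dyad D (lev N)).
  apply: (@le_trans _ _ (\sum_(0 <= c < rdx N) kernel s N x y)); last first.
    by rewrite sumr_const_nat subn0 mulr_natr.
  apply: ler_sum => c _; apply: le_trans (kernel_ge s (leqnn N) xy).
  apply: le_trans JN; apply: ler_sum => j _.
  by rewrite ler_piMr ?powR_ge0 // lern1 leq_b1.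
have ex : exists n, dyad D (lev n) <= rho x y by exists N.
case: (ex_minnP ex) => n hn nmin.
have nN : (n <= N)%N by exact: nmin.
have [m En] : exists m, n = m.+1.
  case: n hn {nmin nN} => [|m _]; last by exists m.
  by rewrite lev0 leNgt /dyad expr0 divr1 rhoD.
rewrite {}En in hn nmin nN.
have xym : rho x y < dyad D (lev m).
  by rewrite ltNge; apply/negP => /nmin; rewrite ltnn.
apply: (@le_trans _ _ (kappa s m * (rdx N)%:R)); last first.
  by rewrite ler_wpM2r // kernel_ge // ltnW.
rewrite exchange_big /=.
have am : 0 < amp m by have /andP[] := amp_itv m.
pose B j := (12 / amp m) ^+ d * (dyad D j ^+ d * (dyad D j) `^ (- s)) * (rdx N)%:R.
have B0 j : 0 <= B j.
  rewrite !mulr_ge0 ?powR_ge0 ?exprn_ge0 // ?divr_ge0 ?ltW //; exact: dyad_gt0.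
(* Scales finer than [dyad D (lev m.+1)] are below [rho x y] and contribute nothing. *)
apply: (@le_trans _ _ (\sum_(j < J.+1) B j * (j < (lev m.+1).+1)%N%:R)).
  apply: ler_sum => j _; rewrite -mulr_sumr.
  case: (leqP j (lev m.+1)) => jm.
    rewrite ltnS jm mulr1 /B.
    have := @walk_count m N x y (dyad D j) (fun l => v x l - v y l) nN hn.
    rewrite dyad_le // => /(_ jm) h.
    have -> : (12 / amp m) ^+ d * (dyad D j ^+ d * dyad D j `^ (- s)) * (rdx N)%:R =
      dyad D j `^ (- s) * ((12 * dyad D j / amp m) ^+ d * (rdx N)%:R).
      by rewrite [12 * _ / _]mulrAC [(_ * dyad D j) ^+ d]exprMn; ring.
    rewrite ler_wpM2l ?powR_ge0 //; apply: le_trans h; apply: ler_sum => c _.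
    rewrite ler_nat /close; case: (_ <= _) => //=.
    rewrite (_ : [forall l, _] = [forall l, `|v x l - v y l + (walk N c x l - walk N c y l)| <= dyad D j]) //.
    by apply: eq_forallb => l; congr (`| _ | <= _); ring.
  rewrite ltnS leqNgt jm /= mulr0 big1 ?mulr0 // => c _.
  rewrite /close (_ : (rho x y <= _) = false) //.
  by apply/negbTE; rewrite -ltNge; apply: lt_le_trans hn; rewrite ltNge dyad_le // -ltnNge.
have -> : kappa s m * (rdx N)%:R = \sum_(j < (lev m.+1).+1) B j.
  by rewrite /kappa mulr_sumr mulr_suml.
pose T := maxn J.+1 (lev m.+1).+1.
rewrite (big_ord_widen_cond T xpredT (fun j => B j * (j < (lev m.+1).+1)%N%:R)) ?leq_maxl //.
rewrite [leRHS](big_ord_widen_cond T xpredT B) ?leq_maxr //=.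
rewrite big_mkcond [leRHS]big_mkcond /=; apply: ler_sum => j _.
by case: ifP => _; case: ifP => _; rewrite ?mulr1 ?mulr0.
Qed.

(** Exchanging sums, the average energy of the random graph is at most the energy of [p] on [K] for
    [kernel]; Markov's inequality concludes. *)
Lemma walk_thin_count s eps N J (v : K -> 'I_d -> R) m (p : 'I_m -> R) (z : 'I_m -> K) C :
  0 < eps -> (forall a, 0 <= p a) -> \sum_a p a = 1 ->
  \sum_(j < J.+1) (dyad D j) `^ (- s) <= kappa s N ->
  \sum_a \sum_b p a * p b * kernel s N (z a) (z b) <= C ->
  \sum_(0 <= c < rdx N)
      `[< thin rho D s eps J (fun x l => walk N c x l + v x l) >]%:R
    <= eps * C * (rdx N)%:R.
Proof.
move=> eps0 p0 p1 JN pC; rewrite -mulrA.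
apply: (@thin_count _ _ _ _ _ D0 _ _ _ _ _ _ _ _ p z) => //.
apply: (@le_trans _ _ ((\sum_a \sum_b p a * p b * kernel s N (z a) (z b)) * (rdx N)%:R)); last first.
  by rewrite ler_wpM2r.
rewrite exchange_big /= mulr_suml; apply: ler_sum => a _.
rewrite exchange_big /= mulr_suml; apply: ler_sum => b _.
rewrite -mulr_sumr -[leRHS]mulrA ler_wpM2l ?mulr_ge0 //.
exact: close_count.
Qed.

End RandomWaves.

(** * Hausdorff measures and finite covers *)

Section DyadicScale.
Variables (R : realType) (D : R).
Hypothesis D0 : 0 < D.

Lemma dyad_small (e : R) : 0 < e -> exists j, dyad D j < e.
Proof.
move=> e0; exists (Num.truncn (D / e)).+1; set n := Num.truncn _.
have h : D / e < n.+1%:R by exact: truncnS_gt.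
rewrite /dyad ltr_pdivrMr ?exprn_gt0 //.
have : D < e * n.+1%:R by rewrite mulrC -ltr_pdivrMr.
move/lt_le_trans; apply; rewrite ler_pM2l // -natrX ler_nat.
exact: ltnW (ltn_expl _ _).
Qed.

(** The finest scale above [t] is at most [2 * t]. For [t = 0] there is none, and [e] pays for a
    tiny scale. *)
Lemma dyad_approx (s t e : R) : 0 < s -> 0 <= t -> t < D -> 0 < e ->
  exists j, t < dyad D j /\ dyad D j `^ s <= (2 * t) `^ s + e.
Proof.
move=> s0 t0 tD e0; move: t0; rewrite le_eqVlt => /orP[/eqP <-|t0].
  have [j hj] := @dyad_small (e `^ s^-1) (powR_gt0 _ e0).
  exists j; split; first exact: dyad_gt0.
  rewrite mulr0 powR0 ?gt_eqF // add0r.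
  have -> : e = (e `^ s^-1) `^ s by rewrite -powRrM mulVf ?gt_eqF // powRr1 // ltW.
  by apply: ge0_ler_powR; rewrite ?nnegrE ?powR_ge0 ?ltW // dyad_gt0.
have ex : exists j, dyad D j <= t by have [j hj] := dyad_small t0; exists j; apply/ltW.
case: (ex_minnP ex) => -[|j]; first by rewrite /dyad expr0 divr1 leNgt tD.
move=> hj jmin; exists j; split.
  by rewrite ltNge; apply/negP => /jmin; rewrite ltnn.
rewrite -[leLHS]addr0; apply: lerD; last exact: ltW.
apply: ge0_ler_powR; [exact: ltW|rewrite nnegrE ltW // dyad_gt0 //|
  by rewrite nnegrE mulr_ge0 // ltW|].
by move: hj; rewrite dyadS ler_pdivrMr // mulrC.
Qed.

End DyadicScale.

Section Hausdorff.
Variables (R : realType) (X : Type) (dist : X -> X -> R).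
Hypothesis dist_ge0 : forall x y, 0 <= dist x y.

Lemma dist_le_diam (U : set X) x y : U x -> U y -> ((dist x y)%:E <= diam dist U)%E.
Proof. by move=> Ux Uy; apply: ereal_sup_ubound; exists x => //; exists y. Qed.

Lemma diam_le (U : set X) (r : R) : (forall x y, U x -> U y -> dist x y <= r) ->
  (diam dist U <= r%:E)%E.
Proof. by move=> h; apply/ereal_supP => _ [x Ux [y Uy <-]]; rewrite lee_fin h. Qed.

Lemma diam_pow_ge0 s U : 0 <= diam_pow dist s U.
Proof. by rewrite /diam_pow; case: asboolP => // _; exact: powR_ge0. Qed.

Lemma dist_le_fine_diam (U : set X) (r : R) x y : (diam dist U <= r%:E)%E ->
  U x -> U y -> dist x y <= fine (diam dist U).
Proof.
move=> Ur Ux Uy; have h := dist_le_diam Ux Uy.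
rewrite -lee_fin fineK // fin_real // (lt_le_trans (ltNyr _) h) /=.
exact: le_lt_trans Ur (ltry _).
Qed.

Lemma diam_pow_le s (U : set X) (r : R) : 0 < s -> 0 <= r ->
  (forall x y, U x -> U y -> dist x y <= r) -> diam_pow dist s U <= r `^ s.
Proof.
move=> s0 r0 h; rewrite /diam_pow; case: asboolP => [_|/eqP/set0P[x Ux]].
  exact: powR_ge0.
have Ur := diam_le h.
have f0 : 0 <= fine (diam dist U).
  by apply: le_trans (dist_ge0 x x) (dist_le_fine_diam Ur Ux Ux).
apply: ge0_ler_powR; rewrite ?nnegrE ?(ltW s0) //.
rewrite -lee_fin fineK // fin_real // (lt_le_trans (ltNyr _) (dist_le_diam Ux Ux)) /=.
exact: le_lt_trans Ur (ltry _).
Qed.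

Lemma hausdorff_delta_ge0 s del A : (0 <= hausdorff_delta dist s del A)%E.
Proof.
apply/ereal_infP => _ [U _ <-].
by apply: nneseries_ge0 => n _ _; rewrite lee_fin diam_pow_ge0.
Qed.

Lemma hausdorff_measure0P s A : hausdorff_measure dist s A = 0%E <->
  forall del : R, 0 < del -> hausdorff_delta dist s del A = 0%E.
Proof.
split=> [h del del0|h].
  apply/eqP; rewrite eq_le hausdorff_delta_ge0 andbT -h.
  by apply: ereal_sup_ubound; exists del.
apply/eqP; rewrite eq_le; apply/andP; split.
  by apply/ereal_supP => _ [del del0 <-]; rewrite h.
by apply: ereal_sup_ubound; exists (1 : R); [exact: ltr01|exact: h ltr01].
Qed.

Lemma hausdorff_measure0_finite s A : 0 < s ->
  (forall eps del : R, 0 < eps -> 0 < del ->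
    exists m (U : 'I_m -> set X) (r : 'I_m -> R),
    [/\ forall x, A x -> exists i, U i x,
        forall i x y, U i x -> U i y -> dist x y <= r i,
        forall i, 0 <= r i <= del & \sum_i r i `^ s <= eps]) ->
  hausdorff_measure dist s A = 0%E.
Proof.
move=> s0 h; apply/hausdorff_measure0P => del del0.
apply/eqP; rewrite eq_le hausdorff_delta_ge0 andbT; apply/lee_addgt0Pr => eps eps0.
rewrite add0e; have [m [U [r [AU Ur rd rs]]]] := h eps del eps0 del0.
(* The finite cover is padded with empty sets, whose [diam_pow] is 0. *)
pose W n : set X := if insub n is Some i then U i else set0.
have W0 : diam_pow dist s set0 = 0 by rewrite /diam_pow; case: asboolP.
apply: (@le_trans _ _ (\sum_(n <oo) (diam_pow dist s (W n))%:E)%E).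
  apply: ereal_inf_lbound; exists W => //; split=> [x /AU[i Ui]|n].
    by exists i => //; rewrite /W valK.
  rewrite /W; case: insubP => [i _ _|_].
    apply: le_trans (diam_le (Ur i)) _; rewrite lee_fin; by have /andP[] := rd i.
  by apply: diam_le.
rewrite (nneseries_split 0 m); last by move=> n _; rewrite lee_fin diam_pow_ge0.
rewrite add0n [X in (_ + X)%E]eseries0 ?adde0; last first.
  by move=> n mn _; rewrite /W insubF ?W0 // ltnNge mn.
rewrite big_mkord sumEFin lee_fin; apply: le_trans rs; apply: ler_sum => i _.
have /andP[ri _] := rd i.
by rewrite /W valK; apply: diam_pow_le => // x y; exact: Ur.
Qed.

Lemma hausdorff_measure0_cover s A (eps del : R) :
  hausdorff_measure dist s A = 0%E -> 0 < eps -> 0 < del ->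
  exists U : nat -> set X, [/\ A `<=` \bigcup_n U n,
    forall n, (diam dist (U n) <= del%:E)%E &
    forall N, \sum_(n < N) diam_pow dist s (U n) < eps].
Proof.
move=> /hausdorff_measure0P h eps0 del0.
have : (hausdorff_delta dist s del A < eps%:E)%E by rewrite h // lte_fin.
move=> /ereal_inf_lt[_ [U [AU Ud] <-] Ue]; exists U; split=> // N.
rewrite -lte_fin; apply: le_lt_trans Ue; rewrite -sumEFin.
rewrite -(big_mkord xpredT (fun n => (diam_pow dist s (U n))%:E)).
by apply: nneseries_lim_ge => n _ _; rewrite lee_fin diam_pow_ge0.
Qed.

Lemma hausdorff_measure0_le s t A : 0 <= s -> s <= t ->
  hausdorff_measure dist s A = 0%E -> hausdorff_measure dist t A = 0%E.
Proof.
move=> s0 st h; apply/hausdorff_measure0P => del del0.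
(* On diameters at most 1, raising the exponent lowers the power. *)
pose e := Num.min del 1.
have e0 : 0 < e by rewrite lt_min del0 /=.
move/hausdorff_measure0P : h => /(_ e e0) h.
apply/eqP; rewrite eq_le hausdorff_delta_ge0 andbT -h.
apply/ereal_infP => _ [U [AU Ud] <-].
apply: (@le_trans _ _ (\sum_(n <oo) (diam_pow dist t (U n))%:E)%E).
  apply: ereal_inf_lbound; exists U => //; split=> // n.
  by apply: le_trans (Ud n) _; rewrite lee_fin ge_min lexx.
apply: lee_nneseries => n; first by move=> _; rewrite lee_fin diam_pow_ge0.
move=> _; rewrite lee_fin /diam_pow; case: asboolP => // /eqP/set0P[x Ux].
have fn : fine (diam dist (U n)) <= 1.
  rewrite -lee_fin fineK; last first.
    rewrite fin_real // (lt_le_trans (ltNyr _) (dist_le_diam Ux Ux)) /=.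
    exact: le_lt_trans (Ud n) (ltry _).
  by apply: le_trans (Ud n) _; rewrite lee_fin ge_min lexx orbT.
have f0 : 0 <= fine (diam dist (U n)).
  by apply: le_trans (dist_ge0 x x) (dist_le_fine_diam (Ud n) Ux Ux).
(* Diameter 0 is treated apart: [powR 0 0] is 1, but [t = 0] forces [s = 0]. *)
move: f0; rewrite le_eqVlt => /orP[/eqP <-|f0].
  have [t00|t0] := eqVneq t 0; last by rewrite powR0 // powR_ge0.
  have -> : s = 0 by apply/eqP; rewrite eq_le s0 andbT -t00.
  by rewrite t00.
by apply: ger_powR st; rewrite f0.
Qed.

End Hausdorff.

Section FiniteCover.
Variables (R : realType) (K : Type) (rho : K -> K -> R) (D : R).
Hypotheses (Kc : mcompact rho) (D0 : 0 < D).

Lemma sum_geom (N : nat) : \sum_(n < N) (2 ^+ n.+2)^-1 <= 2^-1 :> R.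
Proof.
suff -> : \sum_(n < N) (2 ^+ n.+2)^-1 = 2^-1 - (2 ^+ N.+1)^-1 :> R.
  by rewrite gerBl invr_ge0 exprn_ge0.
elim: N => [|N IH]; first by rewrite big_ord0 expr1 subrr.
rewrite big_ord_recr /= IH !exprS; field.
by rewrite expf_neq0 // pnatr_eq0.
Qed.

Variables (X : Type) (dist : X -> X -> R) (phi : K -> X) (tau : K -> K -> R) (C : R).
Hypotheses (dist_ge0 : forall x y, 0 <= dist x y) (tauM : is_metric tau).
Hypothesis (tau_open : forall x e, mopen rho [set y | tau x y < e]).
Hypotheses (C0 : 0 < C) (tauC : forall x y, tau x y <= C * dist (phi x) (phi y)).

(* [phi] may be far from an isometry: [tau] replaces [dist] as the metric in which the
   pieces of the cover are thickened to open sets. *)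
Lemma finite_cover (s eps : R) : 0 < s -> 0 < eps ->
  hausdorff_measure dist s (range phi) = 0%E ->
  exists N (V : nat -> set K) (j : nat -> nat),
  [/\ forall x, exists2 n, (n < N)%N & V n x,
      forall n x y, V n x -> V n y -> tau x y <= dyad D (j n) / 2 &
      \sum_(n < N) dyad D (j n) `^ s < eps].
Proof.
move=> s0 e0 H0.
have c16 : 0 < 16 * C by rewrite mulr_gt0.
(* The scale of a piece is taken above [8 * C * t n], and [dyad_approx] costs a further factor 2,
   whence 16. The bound [t n <= D / (16 * C)] keeps [8 * C * t n] below [D]. *)
pose P := (16 * C) `^ s; have P0 : 0 < P by exact: powR_gt0.
have e1 : 0 < eps / 2 / P by rewrite !divr_gt0.
have del0 : 0 < D / (16 * C) by rewrite divr_gt0.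
have [U [AU Ud Us]] := hausdorff_measure0_cover H0 e1 del0.
pose t n : R := if `[< U n = set0 >] then 0 else fine (diam dist (U n)).
have tU n x y : U n x -> U n y -> dist x y <= t n.
  move=> Ux Uy; rewrite /t; case: asboolP => [U0|_]; first by rewrite U0 in Ux.
  exact: dist_le_fine_diam (Ud n) Ux Uy.
have t0 n : 0 <= t n.
  rewrite /t; case: asboolP => // /eqP/set0P[x Ux].
  exact: le_trans (dist_ge0 x x) (dist_le_fine_diam (Ud n) Ux Ux).
have tpow n : t n `^ s = diam_pow dist s (U n).
  by rewrite /t /diam_pow; case: asboolP => // _; rewrite powR0 // gt_eqF.
have td n : t n <= D / (16 * C).
  rewrite /t; case: asboolP => [_|/eqP/set0P[x Ux]]; first exact: ltW.
  have h := @dist_le_diam _ _ dist _ _ _ Ux Ux.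
  rewrite -lee_fin fineK // fin_real // (lt_le_trans (ltNyr _) h) /=.
  exact: le_lt_trans (Ud n) (ltry _).
have /choice[j hj] : forall n, exists j, 8 * C * t n < dyad D j /\
    dyad D j `^ s <= P * t n `^ s + eps * (2 ^+ n.+2)^-1.
  move=> n; have [|||j [h1 h2]] := @dyad_approx R D D0 s (8 * C * t n) (eps * (2 ^+ n.+2)^-1) s0.
  - by rewrite !mulr_ge0 // ltW.
  - have := td n; rewrite ler_pdivlMr // => h.
    rewrite (_ : 8 * C * t n = t n * (16 * C) / 2); last by field.
    by rewrite ltr_pdivrMr //; apply: le_lt_trans h _; rewrite ltr_pMr // ltr1n.
  - by rewrite mulr_gt0 // invr_gt0 exprn_gt0.
  exists j; split=> //; apply: le_trans h2 _; rewrite lerD2r.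
  by rewrite !mulrA -natrM /P powRM // ltW.
(* Thickening by an eighth of the scale makes the pieces open; their [tau]-diameter is at most three
   eighths of it. *)
pose V n := [set x | exists2 y, U n (phi y) & tau y x < dyad D (j n) / 8].
have [|x|N hN] := @mcompact_nat _ _ _ Kc V.
- move=> n x [y Uy xy]; have [e e0' h] := tau_open xy.
  by exists e => // z /h /= hz; exists y.
- have [n _ Un] := AU (phi x) (ex_intro2 _ _ x I erefl).
  exists n, x => //; rewrite (_ : tau x x = 0) ?divr_gt0 ?dyad_gt0 //.
  by case: tauM => _ /(_ x x)[_ ->].
exists N, V, j; split=> // [n x y [x' Ux hx] [y' Uy hy]|].
  have h1 : tau x y <= tau x x' + tau x' y.
    by case: tauM => _ _ _ h; exact: h.
  have h2 : tau x' y <= tau x' y' + tau y' y.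
    by case: tauM => _ _ _ h; exact: h.
  have h3 : tau x' y' <= C * t n by apply: le_trans (tauC _ _) _; rewrite ler_pM2l // tU.
  have [h4 _] := hj n; rewrite -mulrA in h4.
  have {}hx : tau x x' < dyad D (j n) / 8 by case: tauM => _ _ -> _.
  have h5 := dyad_gt0 D0 (j n).
  move: h1 h2 h3 h4 h5 hx hy; clear.
  move: (tau x y) (tau x x') (tau x' y) (tau x' y') (tau y' y) (C * t n) (dyad D _).
  by move=> *; lra.
apply: (@le_lt_trans _ _ (\sum_(n < N) (P * t n `^ s + eps * (2 ^+ n.+2)^-1))).
  by apply: ler_sum => n _; have [] := hj n.
rewrite big_split /= -!mulr_sumr.
have hU : P * \sum_(n < N) t n `^ s < eps / 2.
  rewrite mulrC -ltr_pdivlMr //; apply: le_lt_trans (Us N).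
  by apply: ler_sum => n _; rewrite tpow.
have := sum_geom N; rewrite -(ler_pM2l e0) => hg; lra.
Qed.

End FiniteCover.

(** * Covers of a graph and the upper bound *)

Section Graph.
Variables (R : realType) (K : Type) (rho : K -> K -> R) (d : nat) (D : R).
Hypotheses (rhoM : is_metric rho) (Kc : mcompact rho) (D0 : 0 < D).
Implicit Types f : K -> 'I_d -> R.
Notation gdist := (graph_dist rho (d := d)).

Lemma graph_dist_ge0 p q : 0 <= gdist p q.
Proof. exact: sqrtr_ge0. Qed.

Lemma base_le_graph_dist p q : rho p.1 q.1 <= gdist p q.
Proof.
rewrite -[leLHS]ger0_norm; last by case: rhoM.
by rewrite -sqrtr_sqr ler_wsqrtr // lerDl sqr_ge0.
Qed.

Lemma coord_le_graph_dist p q l : `| p.2 l - q.2 l | <= gdist p q.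
Proof.
apply: le_trans (eucl_ge (fun i => p.2 i - q.2 i) l) _.
rewrite -[leLHS]ger0_norm ?sqrtr_ge0 //.
by rewrite -sqrtr_sqr ler_wsqrtr // lerDr sqr_ge0.
Qed.

Lemma graph_dist_le p q (u : R) : rho p.1 q.1 <= u ->
  (forall l, `| p.2 l - q.2 l | <= u) -> gdist p q <= d.+1%:R * u.
Proof.
move=> h1 /eucl_le h2.
have r0 : 0 <= rho p.1 q.1 by case: rhoM.
have u0 : 0 <= u by apply: le_trans h1.
rewrite -[leRHS]ger0_norm ?mulr_ge0 // -sqrtr_sqr ler_wsqrtr // -natr1 mulrDl mul1r.
set e := eucl _ in h2 *.
have e0 : 0 <= e by exact: sqrtr_ge0.
have h1' : rho p.1 q.1 ^+ 2 <= u ^+ 2 by rewrite lerXn2r ?nnegrE.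
have h2' : e ^+ 2 <= (d%:R * u) ^+ 2 by rewrite lerXn2r ?nnegrE // mulr_ge0.
have du : 0 <= d%:R * u by rewrite mulr_ge0.
rewrite sqrrD; have := mulr_ge0 du u0; move: (d%:R * u * u) => w w0.
by rewrite addrC addrAC; apply: ler_wpDr; [rewrite mulrn_wge0|exact: lerD].
Qed.

(** An [l^1] variant of the graph distance, pulled back to [K]: its triangle inequality is
    immediate, its balls are open when [f] is continuous, and it is at most [d.+1] times
    [graph_dist]. *)
Definition graph_metric f x y : R := rho x y + \sum_l `| f x l - f y l |.

Lemma graph_metricM f : is_metric (graph_metric f).
Proof.
case: rhoM => r0 req rC rT; rewrite /graph_metric.
have S0 x y : 0 <= \sum_l `| f x l - f y l | by apply: sumr_ge0.
split=> [x y|x y|x y|x y z].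
- exact: addr_ge0.
- split=> [|->]; last first.
    by rewrite (req y y).2 // add0r big1 // => l _; rewrite subrr normr0.
  move=> h; apply/req; apply/eqP; rewrite eq_le r0 andbT -h lerDl; exact: S0.
- by rewrite rC; congr (_ + _); apply: eq_bigr => l _; rewrite distrC.
- rewrite addrACA; apply: lerD; first exact: rT.
  rewrite -big_split /=; apply: ler_sum => l _.
  by rewrite -[f x l - f z l](subrKA (f y l)); exact: ler_normD.
Qed.

Lemma graph_metric_open f x e : CK rho f -> mopen rho [set y | graph_metric f x y < e].
Proof.
move=> /CKP fc y /= xy.
have e0 : 0 < (e - graph_metric f x y) / d.+1%:R by rewrite divr_gt0 // subr_gt0.
have [del del0 h] := fc y _ e0.
exists (Num.min del ((e - graph_metric f x y) / d.+1%:R)); first by rewrite lt_min del0.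
move=> z; rewrite lt_min => /andP[/h hz yz].
have [_ _ _ T] := graph_metricM f.
apply: le_lt_trans (T x y z) _; rewrite -ltrBrDl.
rewrite {1}/graph_metric; set w := _ / _ in yz hz *.
have -> : e - graph_metric f x y = w + d%:R * w.
  transitivity (w * d.+1%:R); first by rewrite divfK // pnatr_eq0.
  by rewrite -nat1r mulrDr mulr1 [w * _]mulrC.
apply: ltr_leD => //.
apply: (@le_trans _ _ (\sum_(l < d) w)); first by apply: ler_sum => l _; exact: ltW.
by rewrite sumr_const card_ord mulr_natl.
Qed.

Lemma graph_metric_le f x y : graph_metric f x y <= d.+1%:R * gdist (x, f x) (y, f y).
Proof.
rewrite /graph_metric -nat1r mulrDl mul1r.
apply: lerD; first exact: (base_le_graph_dist (x, f x) (y, f y)).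
apply: (@le_trans _ _ (\sum_(l < d) gdist (x, f x) (y, f y))).
  by apply: ler_sum => l _; exact: (coord_le_graph_dist (x, f x) (y, f y)).
by rewrite sumr_const card_ord mulr_natl.
Qed.

Lemma graph_thin f s eps : CK rho f -> 0 < s -> 0 < eps ->
  hausdorff_measure gdist s (graph f) = 0%E -> exists J, thin rho D s eps J f.
Proof.
move=> fC s0 e0 H0.
have [|N [V [j [Vc Vd Vs]]]] := @finite_cover R K rho D Kc D0 _ gdist (fun x => (x, f x))
  (graph_metric f) d.+1%:R graph_dist_ge0 (graph_metricM f)
  (fun x e => @graph_metric_open f x e fC) _ (graph_metric_le f) s eps s0 e0 H0.
  by rewrite ltr0n.
pose J := \max_(n < N) j n.
(* [finite_cover] uses only half of each scale; the slack fits in the other half because [dyad D J]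
   is the finest scale present. *)
exists J, N, (fun n : 'I_N => V n), (fun n : 'I_N => j n), (dyad D J / 2).
have jJ (i : 'I_N) : (j i <= J)%N by exact: leq_bigmax.
split=> // [|x|i x y Vx Vy].
- by rewrite divr_gt0 // dyad_gt0.
- by have [n nN Vn] := Vc x; exists (Ordinal nN).
have := Vd i x y Vx Vy; rewrite /graph_metric => h.
have S0 : 0 <= \sum_l `| f x l - f y l | by apply: sumr_ge0.
have r0 : 0 <= rho x y by case: rhoM.
have u0 := dyad_gt0 D0 (j i).
have uJ : dyad D J <= dyad D (j i) by rewrite dyad_le.
split=> [|l]; first by move: h S0 u0; clear; lra.
have : `| f x l - f y l | <= \sum_l `| f x l - f y l |.
  by rewrite [leRHS](bigD1 l) //= lerDl sumr_ge0.
by move: h r0 uJ; clear; move: (\sum_l _) `| _ | => a b; lra.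
Qed.

(** A piece of scale [u] is cut by the values of [f] into at most [(2 * c / u + 1) ^ d] parts of
    diameter at most [(d + 1) * u]. The number of parts compensates [u ^ d], and [u <= D] bounds the
    total by [Q * u ^ t]. *)
Lemma graph_upper f s t : CK rho f -> 0 <= s -> s < t ->
  hausdorff_measure rho s [set: K] = 0%E ->
  hausdorff_measure gdist (t + d%:R) (graph f) = 0%E.
Proof.
move=> fC s0 st Hs.
have rho0 : forall x y, 0 <= rho x y by case: rhoM.
have t0 : 0 < t by exact: le_lt_trans st.
have Ht : hausdorff_measure rho t (range (@id K)) = 0%E.
  by rewrite image_id; apply: hausdorff_measure0_le Hs => //; exact: ltW.
have [c c0 fc] := CK_bounded Kc fC.
apply: hausdorff_measure0_finite; first exact: graph_dist_ge0.
  by rewrite ltr_wpDr.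
move=> eps del eps0 del0.
pose Q : R := d.+1%:R `^ (t + d%:R) * (2 * c + D) ^+ d.
have Q0 : 0 < Q.
  by rewrite mulr_gt0 ?powR_gt0 ?exprn_gt0 // addr_gt0 // mulr_gt0.
(* A single term is at most the whole sum, so the second bound forces [(d + 1) * u <= del] for every
   piece. *)
pose e1 := Num.min (eps / Q) ((del / d.+1%:R) `^ t).
have e10 : 0 < e1 by rewrite lt_min divr_gt0 //= powR_gt0 // divr_gt0.
have [N [V [j [Vc Vd Vs]]]] := @finite_cover R K rho D Kc D0 _ rho id
  rho 1 rho0 rhoM (mopen_ball rhoM) ltr01
  (fun x y => eq_ind_r (fun z => rho x y <= z) (lexx (rho x y)) (mul1r (rho x y)))
  t e1 t0 e10 Ht.
have [u uE] : exists u : 'I_N -> R, forall n : 'I_N, dyad D (j n) = u n.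
  by exists (fun n => dyad D (j n)).
have u0 n : 0 < u n by rewrite -uE; exact: dyad_gt0.
have uD n : u n <= D.
  by rewrite -uE -[leRHS]divr1 -[X in _ / X](expr0 2) dyad_le.
have sE : \sum_(n < N) dyad D (j n) `^ t = \sum_n u n `^ t.
  by apply: eq_bigr => n _; rewrite uE.
rewrite {}sE in Vs.
have ut n : u n `^ t <= \sum_n u n `^ t.
  by rewrite (bigD1 n) //= lerDl sumr_ge0 // => i _; exact: powR_ge0.
have udel n : d.+1%:R * u n <= del.
  rewrite mulrC -ler_pdivlMr // leNgt; apply/negP => h.
  have : (del / d.+1%:R) `^ t <= u n `^ t.
    by apply: ge0_ler_powR; rewrite ?nnegrE ?ltW // divr_gt0.
  rewrite leNgt => /negP; apply; apply: le_lt_trans (ut n) _.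
  by apply: lt_le_trans Vs _; rewrite ge_min lexx orbT.
pose B (n : 'I_N) := (Num.truncn (2 * c / u n)).+1.
pose T := {n : 'I_N & {ffun 'I_d -> 'I_(B n)}}.
pose U (p : T) : set (K * ('I_d -> R)) := [set z | [/\ V (tag p) z.1, z.2 = f z.1 &
  forall l, Num.truncn ((z.2 l + c) / u (tag p)) = tagged p l]].
exists #|{: T}|, (U \o enum_val), (fun i => d.+1%:R * u (tag (enum_val i))).
have fp x l n : 0 <= (f x l + c) / u n.
  by rewrite divr_ge0 ?(ltW (u0 n)) //; have := fc x l; rewrite ler_norml => /andP[]; lra.
split=> [_ [x _ <-]|i [x a] [y b] [/= Vx -> hx] [/= Vy -> hy]|i|].
- have [n nN Vx] := Vc x.
  have lt l : (Num.truncn ((f x l + c) / u (Ordinal nN)) < B (Ordinal nN))%N.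
    rewrite ltnS le_truncn // ler_pM2r ?invr_gt0 //.
    by have := fc x l; rewrite ler_norml => /andP[_]; lra.
  pose p : T := Tagged (fun n => {ffun 'I_d -> 'I_(B n)}) [ffun l => Ordinal (lt l)].
  exists (enum_rank p); rewrite /= enum_rankK; split=> //= l.
  by rewrite /p /= ffunE.
- move: hx hy Vx Vy; set p := enum_val i => hx hy Vx Vy.
  apply: graph_dist_le => /= [|l].
    apply: le_trans (Vd _ _ _ Vx Vy) _; rewrite uE.
    by rewrite ler_piMr ?(ltW (u0 (tag p))) // invf_le1 // ler1n.
  have := truncn_itv (fp x l (tag p)); have := truncn_itv (fp y l (tag p)).
  rewrite hx hy !ler_pdivlMr // !ltr_pdivrMr // -natr1 mulrDl mul1r.
  move: (_ * u _) => w /andP[a1 a2] /andP[b1 b2].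
  rewrite ler_norml; move: a1 a2 b1 b2; clear; move: (u _) => *.
  by apply/andP; split; lra.
- by rewrite udel mulr_ge0 ?ltW.
rewrite -(big_enum_val (fun p : T => (d.+1%:R * u (tag p)) `^ (t + d%:R))) /=.
rewrite -(sig_big_dep xpredT (fun=> xpredT) (fun n (_ : {ffun 'I_d -> 'I_(B n)}) => (d.+1%:R * u n) `^ (t + d%:R))) /=.
have : \sum_(n < N) Q * u n `^ t <= eps.
  rewrite -mulr_sumr mulrC -ler_pdivlMr //; apply: le_trans (ltW Vs) _.
  by rewrite ge_min lexx.
apply: le_trans; apply: ler_sum => n _.
rewrite sumr_const card_ffun !card_ord -[leLHS]mulr_natl natrX.
rewrite powRM ?(ltW (u0 n)) // [u n `^ (t + _)]powRD ?(gt_eqF (u0 n)) ?implybT // powR_mulrn ?(ltW (u0 n)) //.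
have -> : (B n)%:R ^+ d * (d.+1%:R `^ (t + d%:R) * (u n `^ t * u n ^+ d)) =
  d.+1%:R `^ (t + d%:R) * ((B n)%:R * u n) ^+ d * u n `^ t by rewrite exprMn; ring.
rewrite ler_wpM2r ?powR_ge0 // ler_wpM2l ?powR_ge0 //.
rewrite lerXn2r ?nnegrE ?mulr_ge0 ?(ltW (u0 n)) ?addr_ge0 ?mulr_ge0 ?(ltW c0) ?(ltW D0) //.
rewrite /B -natr1 mulrDl mul1r; apply: lerD => //.
by rewrite -ler_pdivlMr // truncn_le divr_ge0 ?(ltW (u0 n)) // mulr_ge0 // ltW.
Qed.

End Graph.

(** * Measures of bounded energy *)

Section Capacity.
Variables (R : realType) (K : Type) (rho : K -> K -> R) (D : R).
Hypotheses (rhoM : is_metric rho) (Kc : mcompact rho) (D0 : 0 < D).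
Hypothesis rhoD : forall x y, rho x y < D.

(** A cover with a small sum has small pieces, so the content, which puts no limit on diameters,
    vanishes only together with the Hausdorff measure. *)
Lemma content_gt0 (t : R) : 0 < t -> hausdorff_measure rho t [set: K] <> 0%E ->
  exists2 S : R, 0 < S & forall m (V : 'I_m -> set K) (r : 'I_m -> R),
    (forall x, exists i, V i x) -> (forall i x y, V i x -> V i y -> rho x y <= r i) ->
    (forall i, 0 <= r i) -> S <= \sum_i r i `^ t.
Proof.
move=> t0 Ht; apply: contrapT => nS; apply: Ht.
apply: hausdorff_measure0_finite => //; first by case: rhoM.
move=> eps del eps0 del0.
pose e := Num.min eps (del `^ t).
have e0 : 0 < e by rewrite lt_min eps0 powR_gt0.
apply: contrapT => nex; apply: nS; exists e => // m V r Vc Vr r0.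
rewrite leNgt; apply/negP => re; apply: nex.
exists m, V, r; split=> // [i|]; last first.
  by apply: ltW; apply: lt_le_trans re _; rewrite ge_min lexx.
rewrite r0 /= leNgt; apply/negP => ri.
have : del `^ t <= r i `^ t.
  by apply: ge0_ler_powR; rewrite ?nnegrE ?(ltW t0) ?(ltW del0) ?r0 ?(ltW ri).
rewrite leNgt => /negP; apply; apply: (@le_lt_trans _ _ (\sum_i r i `^ t)).
  by rewrite [leRHS](bigD1 i) //= lerDl sumr_ge0 // => k _; exact: powR_ge0.
by apply: lt_le_trans re _; rewrite ge_min lexx orbT.
Qed.

(* Vitali selection: process the balls from the largest, keeping those disjoint from
   the ones kept before. *)
Lemma greedy_selection (T : eqType) (lv : T -> nat) (meets : rel T) (s : seq T) :
  (forall a, meets a a) -> sorted (fun a b => lv b <= lv a)%N s ->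
  exists S : seq T, [/\ uniq S, {subset S <= s},
    forall a b, a \in S -> b \in S -> a != b -> ~~ (meets a b && meets b a) &
    forall a, a \in s -> exists b, [/\ b \in S, (lv b <= lv a)%N & meets a b && meets b a]].
Proof.
move=> mxx; elim: s => [|a s IH] /=; first by exists [::].
move=> pa; have sa : all (fun b => (lv b <= lv a)%N) s.
  by apply: (order_path_min _ pa) => x y z /= h1 h2; exact: leq_trans h2 h1.
have [S [uS sS dS cS]] := IH (path_sorted pa).
have [/hasP[b bS ab]|/hasPn nab] := boolP (has (fun b => meets a b && meets b a) S).
  exists S; split=> // [x /sS|x]; first by rewrite inE orbC => ->.
  rewrite inE => /orP[/eqP ->|/cS //].
  by exists b; split=> //; have /allP := sa; apply; exact: sS.
exists (a :: S); split=> /=.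
- rewrite uS andbT; apply/negP => /nab; by rewrite mxx.
- by move=> x; rewrite !inE => /orP[->//|/sS ->]; rewrite orbT.
- move=> x y; rewrite !inE => /orP[/eqP ->|xS] /orP[/eqP ->|yS]; rewrite ?eqxx // => xy.
  + exact: nab.
  + by rewrite andbC; exact: nab.
  + exact: dS.
- move=> x; rewrite inE => /orP[/eqP ->|/cS[b [bS h1 h2]]].
    by exists a; rewrite !inE eqxx mxx.
  by exists b; rewrite inE bS orbT.
Qed.

Lemma sum_mix q (p F : 'I_q -> R) (tau : R) a :
  \sum_c ((1 - tau) * p c + tau * (c == a)%:R) * F c =
  (1 - tau) * \sum_c p c * F c + tau * F a.
Proof.
under eq_bigr do rewrite mulrDl.
rewrite big_split /= mulr_sumr; congr (_ + _).
  by apply: eq_bigr => c _; rewrite mulrA.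
rewrite (bigD1 a) //= eqxx mulr1 big1 ?addr0 // => c /negbTE ->.
by rewrite mulr0 mul0r.
Qed.

(* Moving mass towards a point of small potential would decrease the energy. *)
Lemma near_minimizer q (k : 'I_q.+1 -> 'I_q.+1 -> R) (lo hi : R) :
  0 < lo -> (forall a b, lo <= k a b <= hi) -> (forall a b, k a b = k b a) ->
  exists p : 'I_q.+1 -> R, [/\ forall a, 0 <= p a, \sum_a p a = 1 &
    forall a, (\sum_b \sum_c p b * p c * k b c) / 2 <= \sum_b p b * k a b].
Proof.
move=> lo0 klh kC.
pose E (p : 'I_q.+1 -> R) := \sum_b \sum_c p b * p c * k b c.
pose prob (p : 'I_q.+1 -> R) := (forall a, 0 <= p a) /\ \sum_a p a = 1.
have Elo p : prob p -> lo <= E p.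
  move=> [p0 p1]; have -> : lo = \sum_b \sum_c p b * p c * lo.
    under eq_bigr do rewrite -mulr_suml -mulr_sumr p1 mulr1.
    by rewrite -mulr_suml p1 mul1r.
  apply: ler_sum => b _; apply: ler_sum => c _.
  by rewrite ler_wpM2l ?mulr_ge0 //; have /andP[] := klh b c.
have lohi : lo <= hi by have /andP[h1 h2] := klh ord0 ord0; exact: le_trans h2.
have hi0 : 0 < hi by exact: lt_le_trans lohi.
pose A : set R := [set E p | p in prob].
have Ai : has_inf A.
  split; last by exists lo => _ [p hp <-]; exact: Elo.
  exists (E (fun a => (a == ord0)%:R)), (fun a => (a == ord0)%:R) => //.
  split=> [a|]; first by case: eqP.
  by rewrite (bigD1 ord0) //= big1 ?addr0 // => a /negbTE ->.
have eta0 : 0 < lo ^+ 2 / (8 * hi) by rewrite divr_gt0 ?exprn_gt0 // mulr_gt0.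
have [_ [p [p0 p1] <-] pE] := inf_adherent eta0 Ai.
exists p; split=> // a; rewrite -/(E p) leNgt; apply/negP => Ua.
(* This [tau] minimizes [- tau * lo + tau ^+ 2 * hi]; the energy drops by [lo ^+ 2 / (4 * hi)],
   twice the tolerance allowed above the infimum. *)
pose tau := lo / (2 * hi).
have t0 : 0 < tau by rewrite divr_gt0 // mulr_gt0.
have t1 : tau <= 1.
  by rewrite ler_pdivrMr ?mulr_gt0 // mul1r; apply: le_trans lohi _; rewrite ler_peMl ?(ltW hi0) // ler1n.
pose p' b := (1 - tau) * p b + tau * (b == a)%:R.
have p'prob : prob p'.
  split=> [b|]; first by rewrite addr_ge0 // mulr_ge0 ?(ltW t0) // subr_ge0.
  have := sum_mix p (fun=> 1) tau a; under eq_bigr do rewrite mulr1.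
  by move=> ->; under eq_bigr do rewrite mulr1; rewrite p1; ring.
pose U b := \sum_c p c * k b c.
have EU : E p = \sum_b p b * U b.
  by apply: eq_bigr => b _; rewrite mulr_sumr; apply: eq_bigr => c _; rewrite mulrA.
have E'E : E p' = (1 - tau) * ((1 - tau) * E p + tau * U a) +
    tau * ((1 - tau) * U a + tau * k a a).
  have -> : E p' = \sum_b p' b * ((1 - tau) * U b + tau * k b a).
    apply: eq_bigr => b _; rewrite -(sum_mix p (k b)) mulr_sumr.
    by apply: eq_bigr => c _; rewrite mulrA.
  rewrite sum_mix; congr (_ * _ + _).
  under eq_bigr do rewrite mulrDr.
  rewrite big_split /= EU !mulr_sumr; congr (_ + _); apply: eq_bigr => b _; first by ring.
  by rewrite kC; ring.
have Einf : inf A <= E p' by apply: ge_inf; [case: Ai|exists p'].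
have kaa : k a a <= hi by have /andP[] := klh a a.
have El : lo <= E p by exact: Elo.
have key : E p' <= E p - tau * lo + tau ^+ 2 * hi.
  rewrite E'E.
  have h1 : tau * (1 - tau) * U a <= tau * (1 - tau) * (E p / 2).
    by rewrite ler_wpM2l ?(ltW Ua) // mulr_ge0 ?subr_ge0 ?(ltW t0).
  have h2 : tau ^+ 2 * k a a <= tau ^+ 2 * hi by rewrite ler_wpM2l // sqr_ge0.
  have h3 : tau * lo <= tau * E p by rewrite ler_pM2l.
  have -> : (1 - tau) * ((1 - tau) * E p + tau * U a) +
    tau * ((1 - tau) * U a + tau * k a a) =
    E p - tau * E p * (1 + (1 - tau)) + 2 * (tau * (1 - tau) * U a) + tau ^+ 2 * k a a by ring.
  have e2 : 2 * (tau * (1 - tau) * (E p / 2)) = tau * E p * (1 - tau) by field.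
  move: h1 h2 h3 e2; rewrite [tau * E p * (1 + _)]mulrDr mulr1; clear.
  move: (tau * E p * (1 - tau)) (tau * (1 - tau) * U a) (tau * (1 - tau) * (E p / 2)).
  move: (tau ^+ 2 * k a a) (tau ^+ 2 * hi) (tau * lo) (tau * E p) (E p).
  by move=> *; lra.
have e3 : - (tau * lo) + tau ^+ 2 * hi = - (2 * (lo ^+ 2 / (8 * hi))).
  by rewrite /tau; field; rewrite gt_eqF.
move: key Einf pE eta0; rewrite -addrA e3; clear.
move: (_ / (8 * hi)) (E p) (E p') (inf A); move=> *; lra.
Qed.

Variable kap : nat -> R.
Hypothesis kap0 : forall m, 0 < kap m.

Definition kern N x y : R := \sum_(m < N.+1) kap m * (rho x y < dyad D m)%R%:R.

(** Let [E] be the energy of a near-minimizer. Its potential is at least [E / 2] at each net point,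
    so some ball there, of radius [r], has mass at least [E / (2 * C) * r ^ t]. Disjoint balls have
    total mass at most 1, hence a sum of [r ^ t] at most [2 * C / E]; enlarged, they cover [K], so
    the content [S] is at most [6 ^ t * 2 * C / E]. *)
Lemma capacity (x0 : K) (t C : R) : 0 < t -> hausdorff_measure rho t [set: K] <> 0%E ->
  (forall N, \sum_(m < N) kap m * dyad D m `^ t <= C) ->
  exists C0, forall N, exists m (p : 'I_m -> R) (z : 'I_m -> K),
    [/\ forall a, 0 <= p a, \sum_a p a = 1 &
        \sum_a \sum_b p a * p b * kern N (z a) (z b) <= C0].
Proof.
move=> t0 /(content_gt0 t0)[S S0 hS] kC.
have w0 m : 0 < kap m * dyad D m `^ t by rewrite mulr_gt0 // powR_gt0 // dyad_gt0.
have C0 : 0 < C by apply: lt_le_trans (kC 1%N); rewrite big_ord1.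
exists (6 `^ t * (2 * C) / S) => N.
have [q' [z hz]] := finite_net rhoM Kc (dyad_gt0 D0 N).
case: q' z hz => [|q] z hz; first by have [[]] := hz x0.
have kern_le x y : kern N x y <= \sum_(m < N.+1) kap m.
  by apply: ler_sum => m _; rewrite ler_piMr ?(ltW (kap0 m)) // lern1 leq_b1.
have kern_ge x y : kap 0 <= kern N x y.
  rewrite /kern (bigD1 ord0) //= {1}/dyad expr0 divr1 rhoD mulr1 lerDl sumr_ge0 // => m _.
  by rewrite mulr_ge0 ?(ltW (kap0 m)).
have [||p [p0 p1 pU]] := @near_minimizer q (fun a b => kern N (z a) (z b)) (kap 0)
  (\sum_(m < N.+1) kap m) (kap0 0%N).
- by move=> a b; rewrite kern_ge kern_le.
- by move=> a b; rewrite /kern metricC.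
exists q.+1, p, z; split=> //; set E := \sum_a _ in pU *.
have E0 : 0 < E.
  apply: (@lt_le_trans _ _ (kap 0)) => //.
  have -> : kap 0 = \sum_b \sum_c p b * p c * kap 0.
    under eq_bigr do rewrite -mulr_suml -mulr_sumr p1 mulr1.
    by rewrite -mulr_suml p1 mul1r.
  apply: ler_sum => b _; apply: ler_sum => c _.
  by rewrite ler_wpM2l ?mulr_ge0.
pose ball a m := [pred b | rho (z a) (z b) < dyad D m].
pose nu a m := \sum_(b | ball a m b) p b.
(* Otherwise [kC] would put the potential at [z a] strictly below [E / 2]. *)
have /choice[lv hlv] : forall a, exists m, (m <= N)%N /\ E / 2 / C * dyad D m `^ t <= nu a m.
  move=> a; apply: contrapT => nex.
  have lt (m : 'I_N.+1) : nu a m < E / 2 / C * dyad D m `^ t.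
    by rewrite ltNge; apply/negP => h; apply: nex; exists m; rewrite -ltnS.
  have : \sum_b p b * kern N (z a) (z b) < E / 2.
    have -> : \sum_b p b * kern N (z a) (z b) = \sum_(m < N.+1) kap m * nu a m.
      under eq_bigr do rewrite mulr_sumr.
      rewrite exchange_big /=; apply: eq_bigr => m _.
      rewrite /nu mulr_sumr [RHS]big_mkcond /=; apply: eq_bigr => b _.
      by case: ifP => _; rewrite ?mulr1 ?mulr0 // mulrC.
    apply: (@lt_le_trans _ _ (\sum_(m < N.+1) kap m * (E / 2 / C * dyad D m `^ t))).
      rewrite [ltRHS]big_ord_recl [ltLHS]big_ord_recl; apply: ltr_leD.
        by rewrite ltr_pM2l // (lt ord0).
      apply: ler_sum => m _; rewrite ler_pM2l //; exact: ltW (lt _).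
    have -> : \sum_(m < N.+1) kap m * (E / 2 / C * dyad D m `^ t) =
      E / 2 / C * \sum_(m < N.+1) kap m * dyad D m `^ t.
      by rewrite mulr_sumr; apply: eq_bigr => m _; ring.
    apply: (@le_trans _ _ (E / 2 / C * C)); last by rewrite divfK // gt_eqF.
    by rewrite ler_pM2l // !divr_gt0.
  by rewrite ltNge pU.
(* Sharing a net point is the relevant notion: selected balls then have disjoint sets of atoms. *)
pose meets a b := [exists c, ball a (lv a) c && ball b (lv b) c].
have meetsC a b : meets a b = meets b a.
  by apply: eq_existsb => c; rewrite andbC.
have mxx a : meets a a.
  by apply/existsP; exists a; rewrite /= metric_xx // dyad_gt0.
have [|T [uT _ dT cT]] := @greedy_selection _ lv meets
  (sort (fun a b => lv b <= lv a)%N (enum 'I_q.+1)) mxx.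
- by apply: sort_sorted => a b; exact: leq_total.
(* A point within [dyad D N] of [z a] is within three selected radii of the selected centre, since
   [dyad D N] and the radius at [a] are at most the selected one. The diameter is thus at most six
   radii. *)
have Sle : S <= \sum_(i < size T) (6 * dyad D (lv (tnth (in_tuple T) i))) `^ t.
  apply: (hS _ (fun i => [set x | rho (z (tnth (in_tuple T) i)) x
      < 3 * dyad D (lv (tnth (in_tuple T) i))])) => [x|i x y /= hx hy|i].
  - have [a xa] := hz x.
    have [b [bT ba]] : exists b, [/\ b \in T, (lv b <= lv a)%N & meets a b && meets b a].
      by apply: cT; rewrite mem_sort mem_enum.
    move=> /andP[/existsP[c /andP[/= h1 h2]] _].
    have /tnthP[i bi] : b \in in_tuple T by [].
    exists i => /=; rewrite -bi.
    have h3 : dyad D (lv a) <= dyad D (lv b) by rewrite dyad_le.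
    have h4 : dyad D N <= dyad D (lv a) by rewrite dyad_le //; have [] := hlv a.
    have h5 := metric_triangle rhoM (z c) (z b) x.
    have h6 := metric_triangle rhoM (z a) (z c) x.
    have h7 := metricC rhoM (z c) (z a).
    move: h1 h2 h3 h4 h5 h6 h7 xa; clear.
    move: (dyad D (lv a)) (dyad D (lv b)) (dyad D N) (rho (z b) x) (rho (z b) (z c)).
    move: (rho (z c) x) (rho (z c) (z a)) (rho (z a) (z c)) (rho (z a) x).
    by move=> *; lra.
  - have h5 := metric_triangle rhoM (z (tnth (in_tuple T) i)) x y.
    have h7 := metricC rhoM x (z (tnth (in_tuple T) i)).
    move: hx hy h5 h7; clear; move: (tnth _ _) => a.
    move: (dyad _ _) (rho (z a) x) (rho (z a) y) (rho x y) (rho x (z a)).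
    by move=> *; lra.
  - by rewrite mulr_ge0 // ltW // dyad_gt0.
rewrite ler_pdivlMr // mulrC.
apply: le_trans (_ : (\sum_(i < size T) (6 * dyad D (lv (tnth (in_tuple T) i))) `^ t) * E <= _).
  by rewrite ler_pM2r.
rewrite -(big_tnth _ _ T xpredT (fun a => (6 * dyad D (lv a)) `^ t)).
have nuT : \sum_(a <- T) nu a (lv a) <= 1.
  rewrite -p1 /nu.
  under eq_bigr do rewrite big_mkcond.
  rewrite exchange_big /=; apply: ler_sum => b _.
  rewrite -big_mkcond -big_filter.
  have := filter_uniq (fun a => ball a (lv a) b) uT.
  have sT a : a \in [seq a <- T | ball a (lv a) b] -> a \in T /\ ball a (lv a) b.
    by rewrite mem_filter => /andP[].
  move: [seq a <- T | ball a (lv a) b] sT => l'.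
  case: l' => [|a [|a' l]] sT; rewrite ?big_nil ?big_seq1 //.
  have [aT ab] := sT a (mem_head _ _).
  have [|aT' ab'] := sT a'; first by rewrite !inE eqxx orbT.
  rewrite /= inE negb_or => /andP[/andP[aa' _] _].
  have /negP h := dT a a' aT aT' aa'; exfalso; apply: h.
  by rewrite -meetsC andbb; apply/existsP; exists b; rewrite ab ab'.
rewrite mulr_suml.
apply: (@le_trans _ _ (\sum_(a <- T) 6 `^ t * (2 * C) * nu a (lv a))); last first.
  by rewrite -mulr_sumr ler_piMr // !mulr_ge0 ?powR_ge0 // ltW.
apply: ler_sum => a _; have [_] := hlv a.
rewrite powRM // ?(ltW (dyad_gt0 D0 _)) //.
move: (nu _ _) (dyad_gt0 D0 (lv a)) => v u0 h.
have -> : 6 `^ t * dyad D (lv a) `^ t * E =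
  6 `^ t * (2 * C) * (E / 2 / C * dyad D (lv a) `^ t) by field; rewrite gt_eqF.
by rewrite ler_wpM2l // mulr_ge0 ?powR_ge0 // mulr_ge0 // ltW.
Qed.

End Capacity.

(** * A Cantor set in an uncountable compact metric space *)

Section Cantor.
Variables (R : realType) (K : Type) (rho : K -> K -> R) (D : R).
Hypotheses (rhoM : is_metric rho) (Kc : mcompact rho) (D0 : 0 < D).
Hypothesis Ku : uncountable K.

Definition condensation : set K :=
  [set x | forall e, 0 < e -> ~ countable [set y | rho x y < e]].

(** Every point that is not a condensation point lies in a countable ball around a point of one of
    the nets, and there are countably many such balls. *)
Lemma condensation_cocountable (A : set K) : ~ countable A ->
  forall x, exists y, [/\ A y, condensation y & y <> x].
Proof.
move=> Au x; apply: contrapT => nex; apply: Au.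
have /choice[w hw] : forall n, exists w : {q & 'I_q -> K},
    forall x, exists i, rho (projT2 w i) x < dyad D n.
  move=> n; have [q [z hz]] := finite_net rhoM Kc (dyad_gt0 D0 n).
  by exists (existT _ q z).
pose q n := projT1 (w n); pose z n : 'I_(q n) -> K := projT2 (w n).
have hz n v : exists i, rho (z n i) v < dyad D n by exact: hw.
pose G n : set K := if n is n'.+1 then
  \bigcup_(i in [set i : 'I_(q n') | countable [set y | rho (z n' i) y < dyad D n']])
     [set y | rho (z n' i) y < dyad D n'] else [set x].
apply: (@sub_countable _ _ _ (\bigcup_n G n)).
  apply: subset_card_le => y Ay.
  have [->|yx] := pselect (y = x); first by exists 0%N.
  have ny : ~ condensation y by move=> cy; apply: nex; exists y.
  have [e [e0 ce]] : exists e, 0 < e /\ countable [set v | rho y v < e].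
    apply: contrapT => h; apply: ny => e e0 ce; apply: h; by exists e.
  have [n hn] := dyad_small D (divr_gt0 e0 (ltr0n R 2)).
  have [i hi] := hz n y; exists n.+1 => //; exists i => //=.
  apply: sub_countable ce; apply: subset_card_le => v /= hv.
  have := metric_triangle rhoM (z n i) y v; have := metricC rhoM y (z n i); lra.
apply: bigcup_countable => // -[|n] _ /=; first exact: countable1.
by apply: bigcup_countable => //; exact: countableP.
Qed.

Lemma condensation_near x e : condensation x -> 0 < e ->
  exists y, [/\ condensation y, y <> x & rho x y < e].
Proof.
by move=> cx e0; have [y [h1 h2 h3]] := condensation_cocountable (cx e e0) x; exists y.
Qed.

Lemma metric_gt0 x y : x <> y -> 0 < rho x y.
Proof.
case: rhoM => r0 req _ _ xy; rewrite lt_neqAle r0 andbT eq_sym.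
by apply/eqP => /req.
Qed.

Lemma separation (n : nat) (pt : nat -> K) :
  (forall a b, (a < n)%N -> (b < n)%N -> a <> b -> pt a <> pt b) ->
  exists L, forall a b, (a < n)%N -> (b < n)%N -> a <> b -> 2 * dyad D L <= rho (pt a) (pt b).
Proof.
move=> inj.
pose e := \big[Num.min/1]_(p : 'I_n * 'I_n | p.1 != p.2) rho (pt p.1) (pt p.2).
have e0 : 0 < e.
  apply: lt_bigmin => // -[a b] /= ab; apply: metric_gt0; apply: inj => //.
  by move/val_inj/eqP; exact/negP.
have [L hL] := dyad_small D (divr_gt0 e0 (ltr0n R 2)).
exists L => a b an bn ab; apply: (@le_trans _ _ e); first by lra.
apply: (@bigmin_le_cond _ _ _ _ (Ordinal an, Ordinal bn)) => /=.
by apply/eqP => /(congr1 val).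
Qed.

(* Stage [N] has [2 ^ N] points; the points [2 a] and [2 a + 1] of stage [N + 1] lie
   close to the point [a] of stage [N]. *)
Lemma cantor_scheme : exists (lev : nat -> nat) (pt : nat -> nat -> K), lev 0%N = 0%N /\
  forall N m a b, (m <= N)%N -> (a < 2 ^ N)%N -> (b < 2 ^ N)%N ->
    (a %/ 2 ^ (N - m) <> b %/ 2 ^ (N - m))%N -> dyad D (lev m) <= rho (pt N a) (pt N b).
Proof.
have nKT : ~ countable [set: K].
  by move=> /countable_injP[f fi]; apply: Ku; exists f => x y; apply: fi; rewrite inE.
have [x0 cx0] : exists x, condensation x.
  have [x0] : exists x : K, True.
    apply: contrapT => h; apply: nKT; apply/countable_injP.
    by exists (fun=> 0%N) => x; case: h; exists x.
  by move=> _; have [x [_ cx _]] := condensation_cocountable nKT x0; exists x.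
pose good (st : nat * (nat -> K) * nat) :=
  (forall a, condensation (st.1.2 a)) /\
  forall a b, (a < 2 ^ st.1.1)%N -> (b < 2 ^ st.1.1)%N -> a <> b ->
     2 * dyad D st.2 <= rho (st.1.2 a) (st.1.2 b).
pose next (st st' : nat * (nat -> K) * nat) := [/\ st'.1.1 = st.1.1.+1,
  forall a, rho (st'.1.2 a) (st.1.2 (a %/ 2)%N) <= dyad D st.2 / 4 &
  dyad D st'.2 <= dyad D st.2 / 2].
have /choice[step hstep] : forall st, exists st', good st -> good st' /\ next st st'.
  move=> [[n pt] L]; have [[/= cpt sep]|ng] := pselect (good (n, pt, L)); last first.
    by exists (n, pt, L).
  have dL := dyad_gt0 D0 L.
  have /choice[y hy] : forall a, exists y,
      [/\ condensation y, y <> pt a & rho (pt a) y < dyad D L / 4].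
    by move=> a; apply: condensation_near => //; rewrite divr_gt0.
  pose pt' a := if odd a then y (a %/ 2)%N else pt (a %/ 2)%N.
  have near a : rho (pt' a) (pt (a %/ 2)%N) <= dyad D L / 4.
    rewrite /pt'; case: ifP => _; last by rewrite metric_xx // divr_ge0 // ltW.
    by rewrite metricC // ltW //; have [] := hy (a %/ 2)%N.
  have [|L' hL'] := @separation (2 ^ n.+1) pt'.
    move=> a b an bn ab ptab.
    have a2 : (a %/ 2 < 2 ^ n)%N by rewrite ltn_divLR // -expnSr.
    have b2 : (b %/ 2 < 2 ^ n)%N by rewrite ltn_divLR // -expnSr.
    have [e2|n2] := eqVneq (a %/ 2)%N (b %/ 2)%N.
      have oab : odd a <> odd b.
        move=> o; apply: ab.
        by rewrite (divn_eq a 2) (divn_eq b 2) e2 !modn2 o.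
      have [_ yp _] := hy (b %/ 2)%N; move: ptab oab; rewrite /pt' e2.
      by case: (odd a); case: (odd b) => // h _; apply: yp; rewrite h.
    have h1 := sep _ _ a2 b2 (elimN eqP n2).
    have h2 := near a; have h3 := near b; rewrite ptab in h2.
    have h4 := metric_triangle rhoM (pt' b) (pt (a %/ 2)%N) (pt (b %/ 2)%N).
    have h5 := metricC rhoM (pt' b) (pt (a %/ 2)%N).
    lra.
  exists (n.+1, pt', maxn L' L.+1) => _; split; [split => /= [a|a b an bn ab]|split => //=].
  - by rewrite /pt'; case: ifP => _ //; have [] := hy (a %/ 2)%N.
  - by apply: le_trans (hL' a b an bn ab); rewrite ler_pM2l // dyad_le // leq_maxl.
  - by rewrite -dyadS dyad_le // leq_maxr.
pose st N := iter N step (0%N, fun=> x0, 0%N).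
have st_good N : good (st N) /\ (st N).1.1 = N.
  elim: N => [|N [IH1 IH2]]; last first.
    by have [h [h1 _ _]] := hstep _ IH1; split => //; rewrite /= h1 IH2.
  split=> //; split=> //= a b; rewrite expn0 !ltnS !leqn0 => /eqP -> /eqP ->; by [].
have st_next N : next (st N) (st N.+1) by have [] := hstep _ (st_good N).1.
pose lev N := (st N).2; pose pt N := (st N).1.2.
exists lev, pt; split=> // N m a b mN aN bN ab.
(* A move of [dyad D L / 4] is at most half the decrease from [dyad D L] to the next scale, so the
   drift telescopes. Two drifts total less than [dyad D (lev m)], half of the separation
   [2 * dyad D (lev m)] of stage [m]. *)
have drift k c : rho (pt (m + k)%N c) (pt m (c %/ 2 ^ k)%N) <=
    dyad D (lev m) / 2 - dyad D (lev (m + k)%N) / 2.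
  elim: k c => [|k IH] c.
    by rewrite addn0 expn0 divn1 metric_xx // subrr.
  have [_ h1 h2] := st_next (m + k)%N.
  have {}h1 := h1 c; have := IH (c %/ 2)%N; rewrite -divnMA -expnS addnS.
  have := metric_triangle rhoM (pt (m + k)%N (c %/ 2)%N) (pt (m + k).+1 c) (pt m (c %/ 2 ^ k.+1)%N).
  move: h1 h2; rewrite -/(pt _) -/(pt _) -/(lev _) -/(lev _); clear.
  move: (dyad D (lev m)) (dyad D (lev (m + k)%N)) (dyad D (lev (m + k).+1)).
  move: (rho _ _) (rho _ _) (rho _ _) => *; lra.
have h1 := drift (N - m)%N a; have h2 := drift (N - m)%N b.
rewrite subnKC // in h1 h2.
have pw : (2 ^ N = 2 ^ m * 2 ^ (N - m))%N by rewrite -expnD subnKC.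
have lt c : (c < 2 ^ N)%N -> (c %/ 2 ^ (N - m) < 2 ^ m)%N.
  by move=> cN; rewrite ltn_divLR ?expn_gt0 // -pw.
have [[_ sep] em] := st_good m; rewrite em in sep.
have h3 := sep _ _ (lt a aN) (lt b bN) ab.
have h4 := metric_triangle rhoM (pt N a) (pt m (a %/ 2 ^ (N - m))%N) (pt m (b %/ 2 ^ (N - m))%N).
have h5 := metric_triangle rhoM (pt N b) (pt N a) (pt m (b %/ 2 ^ (N - m))%N).
have h6 := metricC rhoM (pt N a) (pt m (a %/ 2 ^ (N - m))%N).
have h7 := dyad_gt0 D0 (lev N).
move: h1 h2 h3 h4 h5 h6 h7; rewrite -/(pt _) -/(lev _); clear.
move: (dyad _ _) (dyad _ _) => p q; lra.
Qed.

(** Take equal masses on the [2 ^ N] points of stage [N]: points closer than [dyad D (lev m)] share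
    their ancestor at stage [m], a fraction [1 / 2 ^ m] of the points. The scales come before [kap],
    because [kappa] is built from them. *)
Lemma cantor_energy : exists lev : nat -> nat, lev 0%N = 0%N /\
  forall (kap : nat -> R) C, (forall m, 0 <= kap m) ->
  (forall N, \sum_(m < N) kap m / 2 ^+ m <= C) ->
  forall N, exists n (p : 'I_n -> R) (z : 'I_n -> K),
    [/\ forall a, 0 <= p a, \sum_a p a = 1 &
        \sum_a \sum_b p a * p b *
          (\sum_(m < N.+1) kap m * (rho (z a) (z b) < dyad D (lev m))%R%:R) <= C].
Proof.
have [lev [pt [lev0 sep]]] := cantor_scheme.
exists lev; split=> // kap C kap0 kC N.
have P0 : 0 < (2 ^ N)%:R :> R by rewrite ltr0n expn_gt0.
exists (2 ^ N)%N, (fun=> (2 ^ N)%:R^-1), (pt N); split=> [a||].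
- by rewrite invr_ge0 ltW.
- by rewrite sumr_const card_ord -[LHS]mulr_natl divff // gt_eqF.
apply: le_trans (kC N.+1).
have -> : \sum_(a < 2 ^ N) \sum_(b < 2 ^ N) (2 ^ N)%:R^-1 * (2 ^ N)%:R^-1 *
    (\sum_(m < N.+1) kap m * (rho (pt N a) (pt N b) < dyad D (lev m))%R%:R) =
  \sum_(m < N.+1) kap m * ((2 ^ N)%:R^-1 * (2 ^ N)%:R^-1 *
    \sum_(a < 2 ^ N) \sum_(b < 2 ^ N) (rho (pt N a) (pt N b) < dyad D (lev m))%R%:R).
  under eq_bigr do under eq_bigr do rewrite mulr_sumr.
  under eq_bigr do rewrite exchange_big.
  rewrite exchange_big /=; apply: eq_bigr => m _.
  rewrite !mulr_sumr; apply: eq_bigr => a _; rewrite !mulr_sumr; apply: eq_bigr => b _.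
  by rewrite mulrCA.
apply: ler_sum => m _; rewrite ler_wpM2l //.
have mN : (m <= N)%N by rewrite -ltnS.
set P := (2 ^ (N - m))%N.
have pw : (2 ^ N = 2 ^ m * P)%N by rewrite -expnD subnKC.
have Pgt0 : (0 < P)%N by rewrite expn_gt0.
have cnt (a : 'I_(2 ^ N)) :
    \sum_(b < 2 ^ N) (rho (pt N a) (pt N b) < dyad D (lev m))%R%:R <= P%:R :> R.
  pose E := [pred b : 'I_(2 ^ N) | b %/ P == a %/ P]%N.
  apply: (@le_trans _ _ (\sum_(b < 2 ^ N) (E b)%:R)).
    apply: ler_sum => b _; rewrite ler_nat; rewrite /E /=.
    have [_|ab] := eqVneq (b %/ P)%N (a %/ P)%N; first exact: leq_b1.
    by rewrite ltNge sep // => ba; rewrite -ba eqxx in ab.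
  rewrite sum_ind_card -[leRHS](subrK 1); apply: card_close.
    by rewrite subr_ge0 ler1n.
  move=> i j /eqP iE /eqP jE.
  rewrite lerBrDr addrAC lerBlDr natr1 -natrD ler_nat.
  rewrite (divn_eq j P) jE -iE addnA -mulSn.
  by rewrite (leq_trans (ltn_ceil i Pgt0)) // leq_addr.
apply: (@le_trans _ _ ((2 ^ N)%:R^-1 * (2 ^ N)%:R^-1 * \sum_(a < 2 ^ N) P%:R)).
  by rewrite ler_wpM2l ?ler_sum // mulr_ge0 ?invr_ge0 ?(ltW P0).
rewrite sumr_const card_ord -[X in _ * X]mulr_natr pw natrM natrX.
rewrite le_eqVlt; apply/orP; left; apply/eqP; field.
by rewrite expf_neq0 //= pnatr_eq0 -lt0n.
Qed.

End Cantor.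

(** * Growth of the weights [kappa] *)

Section Growth.
Variable R : realType.
Implicit Types theta D s t : R.

Lemma geom_le theta n : 0 < theta < 1 -> \sum_(j < n) theta ^+ j <= (1 - theta)^-1.
Proof.
move=> /andP[t0 t1]; have d0 : 0 < 1 - theta by rewrite subr_gt0.
suff -> : \sum_(j < n) theta ^+ j = (1 - theta ^+ n) / (1 - theta).
  by rewrite ler_piMl ?invr_ge0 ?(ltW d0) // gerBl exprn_ge0 // ltW.
elim: n => [|n IH]; first by rewrite big_ord0 expr0 subrr mul0r.
by rewrite big_ord_recr /= IH exprS; field; rewrite gt_eqF.
Qed.

(** Write [theta = phi ^+ 2]: by Bernoulli's inequality one [phi ^+ m] absorbs one factor [m.+2],
    and the other is left for the induction. *)
Lemma poly_geom_bounded k theta : 0 < theta < 1 ->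
  exists2 C, 0 < C & forall m, (m.+2)%:R ^+ k * theta ^+ m <= C.
Proof.
elim: k theta => [|k IH] theta t01.
  exists 1 => // m; rewrite expr0 mul1r; have /andP[t0 t1] := t01.
  by rewrite exprn_ile1 // ltW.
have /andP[t0 t1] := t01.
pose phi := Num.sqrt theta.
have p0 : 0 < phi by rewrite sqrtr_gt0.
have pp : theta = phi ^+ 2 by rewrite sqr_sqrtr // ltW.
have p1 : phi < 1 by rewrite -(@ltr_pXn2r _ 2) ?nnegrE ?ltW // -pp expr1n.
have [C C0 hC] := IH phi (introT andP (conj p0 p1)).
pose h := phi^-1 - 1.
have h0 : 0 < h by rewrite subr_gt0 invf_gt1.
have bern m : 1 + m%:R * h <= (phi ^+ m)^-1.
  rewrite -exprVn (_ : phi^-1 = 1 + h); last by rewrite /h; ring.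
  elim: m => [|m IHm]; first by rewrite mul0r addr0 expr0.
  have h1 : 0 <= m%:R * h ^+ 2 by rewrite mulr_ge0 // sqr_ge0.
  rewrite exprS; apply: (@le_trans _ _ ((1 + h) * (1 + m%:R * h))).
    rewrite -natr1 -subr_ge0 (_ : _ - _ = m%:R * h ^+ 2) //; ring.
  by rewrite ler_pM2l // addr_gt0.
exists (C * (2 + h^-1)) => [|m]; first by rewrite mulr_gt0 // addr_gt0 // invr_gt0.
have -> : m.+2%:R ^+ k.+1 * theta ^+ m =
   (m.+2%:R ^+ k * phi ^+ m) * (m.+2%:R * phi ^+ m) by rewrite pp -exprM mulnC exprM exprS; ring.
apply: ler_pM => //; rewrite ?mulr_ge0 ?exprn_ge0 ?(ltW p0) //.
rewrite -ler_pdivlMr ?exprn_gt0 //.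
apply: (@le_trans _ _ ((2 + h^-1) * (1 + m%:R * h))); last first.
  by rewrite ler_pM2l // addr_gt0 // invr_gt0.
rewrite -subr_ge0 (_ : _ - _ = h^-1 + 2 * (m%:R * h)).
  by rewrite addr_ge0 ?mulr_ge0 ?invr_ge0 ?(ltW h0).
by rewrite -[m.+2]addn2 natrD; field; rewrite gt_eqF.
Qed.

Lemma poly_geom_sum k theta : 0 < theta < 1 ->
  exists2 C, 0 < C & forall N, \sum_(m < N) (m.+2)%:R ^+ k * theta ^+ m <= C.
Proof.
move=> t01; have /andP[t0 t1] := t01.
pose phi := Num.sqrt theta.
have p0 : 0 < phi by rewrite sqrtr_gt0.
have pp : theta = phi ^+ 2 by rewrite sqr_sqrtr // ltW.
have p1 : phi < 1 by rewrite -(@ltr_pXn2r _ 2) ?nnegrE ?ltW // -pp expr1n.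
have p01 : 0 < phi < 1 by rewrite p0.
have [C C0 hC] := poly_geom_bounded k p01.
exists (C * (1 - phi)^-1) => [|N]; first by rewrite mulr_gt0 // invr_gt0 subr_gt0.
apply: (@le_trans _ _ (\sum_(m < N) C * phi ^+ m)).
  apply: ler_sum => m _; rewrite pp -exprM mulnC exprM expr2 mulrA.
  by rewrite ler_wpM2r // exprn_ge0 // ltW.
by rewrite -mulr_sumr ler_pM2l // geom_le.
Qed.

Lemma half_powR_itv t : 0 < t -> 0 < (2^-1 : R) `^ t < 1.
Proof.
move=> t0; rewrite powR_gt0 //=.
apply: (@lt_le_trans _ _ (1 `^ t)); last by rewrite powR1.
by apply: gt0_ltr_powR; rewrite ?nnegrE // invf_lt1 // ltr1n.
Qed.

Lemma dyad_powR D t j : 0 < D -> dyad D j `^ t = D `^ t * ((2^-1) `^ t) ^+ j.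
Proof.
move=> D0; rewrite /dyad -exprVn powRM ?(ltW D0) ?exprn_ge0 //.
congr (_ * _); rewrite -[_ ^+ j]powR_mulrn // -powRrM [_ * t]mulrC powRrM.
by rewrite powR_mulrn // powR_ge0.
Qed.

Lemma amp_inv m : (amp R m)^-1 = m.+1%:R * m.+2%:R.
Proof.
apply: (mulIf (x := m.+1%:R^-1 - m.+2%:R^-1)).
  by have /andP[h _] := amp_itv R m; rewrite gt_eqF.
rewrite mulVf; last by have /andP[h _] := amp_itv R m; rewrite gt_eqF.
rewrite -[m.+2]addn1 natrD; set x := m.+1%:R.
have x0 : 0 < x :> R by rewrite ltr0n.
have x1 : x + 1 != 0 by rewrite gt_eqF // addr_gt0.
by move: x x0 x1 => x x0 x1; field; rewrite x1 gt_eqF.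
Qed.

Lemma amp_inv_ge0 m : 0 <= 12 / amp R m.
Proof. by rewrite amp_inv !mulr_ge0. Qed.

Lemma amp_inv_pow d m : (12 / amp R m) ^+ d <= 12 ^+ d * m.+2%:R ^+ (2 * d).
Proof.
rewrite amp_inv exprM -exprMn lerXn2r ?nnegrE ?mulr_ge0 ?sqr_ge0 //.
by rewrite ler_pM2l // expr2 ler_wpM2r // ler_nat.
Qed.

(** For [s < d] the sum over scales in [kappa] is part of a convergent geometric series, whatever
    [lev] is; only the polynomial factor from [amp] remains. *)
Lemma kappa_low d D lev s : 0 < D -> s < d%:R ->
  exists C, forall N, \sum_(m < N) kappa d D lev s m / 2 ^+ m <= C.
Proof.
move=> D0 sd; have b0 : 0 < d%:R - s by rewrite subr_gt0.
have h01 := half_powR_itv b0.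
pose A := D `^ (d%:R - s) * (1 - 2^-1 `^ (d%:R - s))^-1.
have A0 : 0 < A.
  by rewrite mulr_gt0 ?powR_gt0 // invr_gt0 subr_gt0; have /andP[] := h01.
have kA m : kappa d D lev s m <= 12 ^+ d * m.+2%:R ^+ (2 * d) * A.
  rewrite /kappa; apply: ler_pM.
  - by rewrite exprn_ge0 // amp_inv_ge0.
  - apply: sumr_ge0 => j _; rewrite mulr_ge0 ?powR_ge0 // exprn_ge0 // ltW // dyad_gt0 //.
  - exact: amp_inv_pow.
  - under eq_bigr => j _.
      rewrite -powR_mulrn ?(ltW (dyad_gt0 D0 _)) // -powRD ?(gt_eqF (dyad_gt0 D0 _)) ?implybT //.
      rewrite dyad_powR //; over.
    by rewrite -mulr_sumr ler_pM2l ?powR_gt0 // geom_le.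
have half : 0 < (2^-1 : R) < 1 by rewrite invr_gt0 ltr0n invf_lt1 // ltr1n.
have [C C0 hC] := poly_geom_sum (2 * d) half.
exists (12 ^+ d * A * C) => N.
apply: (@le_trans _ _ (12 ^+ d * A * \sum_(m < N) m.+2%:R ^+ (2 * d) * 2^-1 ^+ m)).
  rewrite mulr_sumr; apply: ler_sum => m _; rewrite exprVn mulrA ler_wpM2r ?invr_ge0 ?exprn_ge0 //.
  by rewrite mulrAC.
by rewrite ler_wpM2l // mulr_ge0 ?exprn_ge0 // ltW.
Qed.

(** For [s > d] the finest scale dominates, so [kappa] is at most polynomial times [dyad D m.+1] to
    the power [- (s - d)], and [t > s - d] leaves a geometric decay. *)
Lemma kappa_high d D s t : 0 < D -> d%:R < s -> s - d%:R < t ->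
  exists C, forall N, \sum_(m < N) kappa d D id s m * dyad D m `^ t <= C.
Proof.
move=> D0 sd st; pose b := s - d%:R; have b0 : 0 < b by rewrite subr_gt0.
have tb : 0 < t - b by rewrite subr_gt0.
have h01 := half_powR_itv tb.
have dy j := dyad_gt0 D0 j.
have [C C0 hC] := poly_geom_sum (2 * d).+1 h01.
pose A := 12 ^+ d * (2 `^ b * D `^ (t - b)).
have A0 : 0 < A by rewrite mulr_gt0 ?exprn_gt0 // mulr_gt0 // powR_gt0.
exists (A * C) => N.
apply: (@le_trans _ _ (A * \sum_(m < N) m.+2%:R ^+ (2 * d).+1 * (2^-1 `^ (t - b)) ^+ m)); last first.
  by rewrite ler_pM2l.
rewrite mulr_sumr; apply: ler_sum => m _.
have S : \sum_(j < m.+2) dyad D j ^+ d * dyad D j `^ (- s) <= m.+2%:R * dyad D m.+1 `^ (- b).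
  apply: (@le_trans _ _ (\sum_(j < m.+2) dyad D m.+1 `^ (- b))); last first.
    by rewrite sumr_const card_ord mulr_natl.
  apply: ler_sum => j _.
  rewrite -powR_mulrn ?(ltW (dy _)) // -powRD ?(gt_eqF (dy _)) ?implybT //.
  rewrite (_ : d%:R - s = - b); last by rewrite /b; ring.
  rewrite !powRN lef_pV2 ?posrE ?powR_gt0 //.
  apply: ge0_ler_powR; rewrite ?nnegrE ?(ltW b0) ?(ltW (dy _)) //.
  by rewrite dyad_le // -ltnS.
have E : dyad D m.+1 `^ (- b) * dyad D m `^ t = 2 `^ b * D `^ (t - b) * (2^-1 `^ (t - b)) ^+ m.
  rewrite -[RHS]mulrA -dyad_powR // dyadS powRM ?invr_ge0 ?(ltW (dy _)) //.
  rewrite -[_^-1]powR_inv1 // -powRrM mulN1r opprK.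
  rewrite [X in _ = _ * X]powRD ?(gt_eqF (dy _)) ?implybT //; ring.
rewrite /kappa /=; apply: (@le_trans _ _ ((12 ^+ d * m.+2%:R ^+ (2 * d)) * (m.+2%:R * dyad D m.+1 `^ (- b)) * dyad D m `^ t)).
  rewrite ler_wpM2r ?powR_ge0 //; apply: ler_pM => //.
  - by rewrite exprn_ge0 // amp_inv_ge0.
  - apply: sumr_ge0 => j _; rewrite mulr_ge0 ?powR_ge0 // exprn_ge0 //; exact: ltW.
  - exact: amp_inv_pow.
rewrite -!mulrA E le_eqVlt; apply/orP; left; apply/eqP; rewrite /A exprS; ring.
Qed.

Lemma kappa_gt0 d D lev s m : 0 < D -> 0 < kappa d D lev s m.
Proof.
move=> D0; have dy j := dyad_gt0 D0 j.
rewrite /kappa mulr_gt0 //.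
  by rewrite exprn_gt0 // amp_inv !mulr_gt0.
rewrite big_ord_recl /= ltr_wpDr ?mulr_gt0 ?exprn_gt0 ?powR_gt0 //.
by apply: sumr_ge0 => j _; rewrite mulr_ge0 ?powR_ge0 // exprn_ge0 //; exact: ltW.
Qed.

(** Already the term at scale [D] grows, through [(12 / amp R N) ^+ d]; this allows [N] to be chosen
    after [J] in [close_count]. *)
Lemma kappa_unbounded d D lev s X : (0 < d)%N -> 0 < D ->
  exists N0, forall N, (N0 <= N)%N -> X <= kappa d D lev s N.
Proof.
move=> d0 D0; have dy j := dyad_gt0 D0 j.
pose Y := D ^+ d * D `^ (- s); have Y0 : 0 < Y by rewrite mulr_gt0 ?exprn_gt0 ?powR_gt0.
exists (Num.truncn (X / Y)).+1 => N hN.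
apply: (@le_trans _ _ (N%:R * Y)).
  rewrite -ler_pdivrMr //; apply: ltW; apply: lt_le_trans (truncnS_gt _) _.
  by rewrite ler_nat.
rewrite /kappa; apply: ler_pM => //; first exact: ltW.
  apply: (@le_trans _ _ (12 / amp R N)).
    rewrite amp_inv; apply: (@le_trans _ _ N.+1%:R); first by rewrite ler_nat.
    by rewrite mulrCA ler_peMr // -natrM ler1n.
  apply: ler_eXnr => //; rewrite amp_inv -!natrM ler1n //.
rewrite big_ord_recl /= /dyad expr0 divr1 lerDl.
by apply: sumr_ge0 => j _; rewrite mulr_ge0 ?powR_ge0 // exprn_ge0 //; exact: ltW (dy _).
Qed.

End Growth.

(** * Prevalence *)

Section Prevalence.
Variables (R : realType) (K : Type) (rho : K -> K -> R) (d : nat).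
Hypotheses (rhoM : is_metric rho) (Kc : mcompact rho) (Ku : uncountable K).
Hypothesis d0 : (0 < d)%N.
Notation gdist := (graph_dist rho (d := d)).

Lemma uncountable_inhabited : exists x : K, True.
Proof.
apply: contrapT => h; apply: Ku; exists (fun=> 0%N) => x.
by case: h; exists x.
Qed.

Definition bump (r : R) (z x : K) : R := Num.max 0 (Num.min 1 (2 - rho z x / r)).

Lemma bump_continuous r z x e : 0 < r -> 0 < e -> exists2 del, 0 < del &
  forall y, rho x y < del -> `| bump r z x - bump r z y | < e.
Proof.
move=> r0 e0; exists (r * e) => [|y xy]; first exact: mulr_gt0.
have clamp (a b : R) :
    `| Num.max 0 (Num.min 1 a) - Num.max 0 (Num.min 1 b) | <= `| a - b |.
  rewrite /Num.max /Num.min.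
  case: (ltP 1 a) => ?; case: (ltP 1 b) => ?; rewrite ?ltr01;
    try (case: (ltP 0 a) => ?); try (case: (ltP 0 b) => ?);
    rewrite ler_norml; apply/andP; split;
    have := ler_norm (a - b); have := ler_norm (b - a); rewrite (distrC b a); lra.
apply: le_lt_trans (clamp _ _) _.
have -> : 2 - rho z x / r - (2 - rho z y / r) = (rho z y - rho z x) / r by ring.
rewrite normrM (gtr0_norm (_ : 0 < r^-1)) ?invr_gt0 // ltr_pdivrMr // mulrC.
apply: le_lt_trans xy; rewrite ler_norml.
have := metric_triangle rhoM z x y; have := metric_triangle rhoM y z x.
have := metric_triangle rhoM x z y; have := metricC rhoM x y; have := metricC rhoM x z.
have := metricC rhoM y z => *; apply/andP; split; lra.
Qed.

Lemma thin_open D s eps J (v : K -> 'I_d -> R) :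
  CK_open rho [set f | CK rho f /\ thin rho D s eps J (fun x l => f x l + v x l)].
Proof.
(* A perturbation below [eta / 3] moves each difference of values by less than [2 * eta / 3],
   leaving a slack of [eta / 3]. *)
split=> [f []//|f [fC [n [V [j [eta [eta0 Vc jJ Vd Vs]]]]]]].
exists (eta / 3) => [|g gC fg]; first by rewrite divr_gt0.
split=> //; exists n, V, j, (eta / 3); split=> // [|i x y Vx Vy].
  by rewrite divr_gt0.
have [h1 h2] := Vd i x y Vx Vy; split=> // l.
have hx := le_lt_trans (supdist_ge Kc x l fC gC) fg.
have hy := le_lt_trans (supdist_ge Kc y l fC gC) fg.
have h3 := h2 l.
have -> : g x l + v x l - (g y l + v y l) =
  (f x l + v x l - (f y l + v y l)) - ((f x l - g x l) - (f y l - g y l)) by ring.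
have h4 := ler_normB (f x l + v x l - (f y l + v y l)) ((f x l - g x l) - (f y l - g y l)).
have h5 := ler_normB (f x l - g x l) (f y l - g y l).
lra.
Qed.

Lemma dim_graph_le f : CK rho f ->
  (hausdorff_dim gdist (graph f) <= hausdorff_dim rho [set: K] + (d%:R)%:E)%E.
Proof.
move=> fC; rewrite -leeBlDr //; apply/ereal_infP => _ [s [s0 Hs] <-].
rewrite leeBlDr //; apply/lee_addgt0Pr => e e0.
have [D D0 _] := metric_bounded rhoM Kc.
have se : s < s + e by rewrite ltrDl.
apply: ereal_inf_lbound; exists (s + e + d%:R).
  split; first by rewrite !addr_ge0 // ltW.
  exact: (graph_upper rhoM Kc D0 fC s0 se Hs).
by rewrite !EFinD addeAC.
Qed.

(* When [K] has dimension zero, capacities give nothing and a Cantor set in [K] takes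
   over; it dictates the scales [lev] of the random function. *)
Lemma energy_scales D : 0 < D -> (forall x y, rho x y < D) ->
  exists (lev : nat -> nat) (adm : R -> Prop),
  [/\ lev 0%N = 0%N,
      forall s, adm s -> 0 < s,
      forall s, adm s -> exists C, forall N, exists n (p : 'I_n -> R) (z : 'I_n -> K),
        [/\ forall a, 0 <= p a, \sum_a p a = 1 &
            \sum_a \sum_b p a * p b * kernel rho d D lev s N (z a) (z b) <= C] &
      forall s, 0 <= s -> (s%:E < hausdorff_dim rho [set: K] + (d%:R)%:E)%E ->
        exists2 q : rat, s < ratr q & adm (ratr q)].
Proof.
move=> D0 rhoD; have [x0 _] := uncountable_inhabited.
have rho0 : forall x y, 0 <= rho x y by case: rhoM.
have [[t0 [t00 Ht0]]|zero] :=
  pselect (exists t, 0 < t /\ hausdorff_measure rho t [set: K] <> 0%E).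
  exists id, (fun s => d%:R < s /\
    exists t, s - d%:R < t /\ hausdorff_measure rho t [set: K] <> 0%E).
  split=> // [s [ds _]|s [ds [t [st Ht]]]|s s0 sdim].
  - exact: le_lt_trans ds.
  - have [C hC] := kappa_high D0 ds st.
    have t1 : 0 < t by apply: lt_trans st; rewrite subr_gt0.
    exact: (capacity rhoM Kc D0 rhoD (fun m => kappa_gt0 d id s m D0) x0 t1 Ht hC).
  (* If [t0] is too small and no other [t] works, all measures of exponent above [s - d] vanish,
     contradicting the bound on [s]. *)
  have [t [st Ht]] : exists t, Num.max s d%:R < t + d%:R /\
      hausdorff_measure rho t [set: K] <> 0%E.
    have [st0|t0s] := ltP s (t0 + d%:R).
      by exists t0; rewrite gt_max st0 ltrDr t00.
    apply: contrapT => nt; move: sdim; rewrite ltNge => /negP; apply.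
    rewrite -leeBrDr // -EFinB; apply/lee_addgt0Pr => e e0.
    have sd0 : 0 < s - d%:R by rewrite subr_gt0; apply: lt_le_trans t0s; rewrite ltrDr.
    apply: ereal_inf_lbound; exists (s - d%:R + e) => //; split.
      by rewrite addr_ge0 // ltW.
    apply: contrapT => h; apply: nt; exists (s - d%:R + e); split=> //.
    rewrite gt_max addrAC subrK ltrDl e0 /=; lra.
  have [q] := rat_in_itvoo st; rewrite in_itv /= gt_max => /andP[/andP[sq dq] qt].
  exists q => //; split=> //; exists t; split=> //.
  by rewrite ltrBlDr.
have [lev [lev0 hlev]] := cantor_energy rhoM Kc D0 Ku.
exists lev, (fun s => 0 < s < d%:R); split=> // [s /andP[]//|s /andP[s0 sd]|s s0 sdim].
  have [C hC] := kappa_low lev D0 sd.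
  exists C; apply: hlev => // m; apply: ltW; exact: kappa_gt0.
have sd : s < d%:R.
  rewrite -lte_fin; apply: lt_le_trans sdim _.
  rewrite -[leRHS]add0e leeD2r //; apply/lee_addgt0Pr => e e0; rewrite add0e.
  apply: ereal_inf_lbound; exists e => //; split; first exact: ltW.
  by apply: contrapT => h; apply: zero; exists e.
have [q] := rat_in_itvoo sd; rewrite in_itv /= => /andP[sq qd].
by exists q => //; rewrite qd andbT; exact: le_lt_trans sq.
Qed.

Lemma random_waves D (lev : nat -> nat) : 0 < D -> (forall x y, rho x y < D) ->
  lev 0%N = 0%N ->
  exists (M : nat -> nat) (Phi : nat -> nat -> K -> 'I_d -> R),
  [/\ forall n, (0 < M n)%N, forall N c, CK rho (Phi N c),
      forall N c x l,
        `| Phi N.+1 c x l - Phi N (c %/ M N)%N x l | <= N.+1%:R^-1 - N.+2%:R^-1 &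
      forall s eps N J (v : K -> 'I_d -> R) m (p : 'I_m -> R) (z : 'I_m -> K) C,
        0 < eps -> (forall a, 0 <= p a) -> \sum_a p a = 1 ->
        \sum_(j < J.+1) (dyad D j) `^ (- s) <= kappa d D lev s N ->
        \sum_a \sum_b p a * p b * kernel rho d D lev s N (z a) (z b) <= C ->
        \sum_(0 <= c < radix M N)
            `[< thin rho D s eps J (fun x l => Phi N c x l + v x l) >]%:R
          <= eps * C * (radix M N)%:R].
Proof.
move=> D0 rhoD lev0.
have r0 n : 0 < dyad D (lev n.+1) / 3 by rewrite divr_gt0 // dyad_gt0.
have /choice[w hw] : forall n, exists w : {q & 'I_q -> K},
    forall x, exists i, rho (projT2 w i) x < dyad D (lev n.+1) / 3.
  move=> n; have [q [z hz]] := finite_net rhoM Kc (r0 n).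
  by exists (existT _ q z).
pose q n := projT1 (w n); pose z n : 'I_(q n) -> K := projT2 (w n).
(* A bump is 1 within [r] of its centre and 0 beyond [2 * r]. With [r] a third of the scale, a net
   point within [r] of [x] is at least [2 * r] away from [y]. *)
pose psi n (i : 'I_(q n)) : K -> R := bump (dyad D (lev n.+1) / 3) (z n i).
have psiC n (i : 'I_(q n)) x e : 0 < e -> exists2 del, 0 < del &
    forall y, rho x y < del -> `| psi n i x - psi n i y | < e.
  exact: bump_continuous.
have psi_sep n x y : dyad D (lev n.+1) <= rho x y ->
    exists i, psi n i x = 1 /\ psi n i y = 0.
  move=> xy; have [i hi] := hw n x; exists i; rewrite /psi /bump /z.
  move: hi; set c := projT2 (w n) i; set r := _ / 3 => hi.
  have rn : 0 < r by exact: r0.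
  have hr : dyad D (lev n.+1) = 3 * r by rewrite /r; field.
  have h := metric_triangle rhoM c x y; rewrite (metricC rhoM x c) in h.
  split.
    rewrite min_l ?max_r // lerBrDr -lerBrDl (_ : 2 - 1 = 1); last by ring.
    by rewrite ler_pdivrMr // mul1r ltW.
  rewrite max_l // ge_min; apply/orP; right.
  by rewrite subr_le0 ler_pdivlMr //; lra.
have /choice[g hg] : forall n, exists g, g.+1%:R^-1 <= dyad D (lev n.+1).
  move=> n; have [g hg] := inv_small (dyad_gt0 D0 (lev n.+1)).
  by exists g; exact: ltW.
exists (choices_card d q g), (walk g psi); split.
- exact: choices_card_gt0.
- exact: walkC psiC.
- exact: walk_step.
- move=> s eps N J v m p z' C.
  exact: (walk_thin_count D0 rhoD lev0 psi_sep hg).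
Qed.

Lemma CK_borel_bigcup (A : (set (K -> 'I_d -> R))^nat) :
  (forall n, CK_borel rho (A n)) -> CK_borel rho (\bigcup_n A n).
Proof. by have [_ _] := smallest_sigma_algebra (CK rho (d:=d)) (CK_open rho (d:=d)); apply. Qed.

Lemma CK_borel_bigcap (A : (set (K -> 'I_d -> R))^nat) : (forall n, A n `<=` CK rho (d:=d)) ->
  (forall n, CK_borel rho (A n)) -> CK_borel rho (\bigcap_n A n).
Proof.
move=> AC mA; have [_ mD mU] := smallest_sigma_algebra (CK rho (d:=d)) (CK_open rho (d:=d)).
have -> : \bigcap_n A n = CK rho (d:=d) `\` \bigcup_n (CK rho (d:=d) `\` A n).
  apply/seteqP; split => [f Af|f [fC nf] n _].
    by split; [exact: (AC 0%N _ (Af 0%N I))|move=> [n _ []] _; apply; exact: Af].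
  by apply: contrapT => nAf; apply: nf; exists n.
exact: (mD _ (mU _ (fun n => mD _ (mA n)))).
Qed.

(** The functions with too small a graph dimension are enclosed in [B null]: for some admissible
    rational exponent, covers of arbitrarily small sum exist. Rational exponents make the union
    countable, and openness of [thin] makes the set Borel. *)
Lemma graph_dim_prevalent : for_prevalent rho (fun f =>
  hausdorff_dim gdist (graph f) = (hausdorff_dim rho [set: K] + (d%:R)%:E)%E).
Proof.
have [x0 _] := uncountable_inhabited.
have [D D0 rhoD] := metric_bounded rhoM Kc.
have [lev [adm [lev0 adm0 admE admdim]]] := energy_scales D0 rhoD.
have [M [Phi [M0 PhiC PhiS Phithin]]] := random_waves D0 rhoD lev0.
(* Integers coding no rational give the exponent 0, which [adm0] excludes. *)
pose sq (n : nat) : R := ratr (odflt 0 (unpickle n)).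
pose O (v : K -> 'I_d -> R) q k J : set (K -> 'I_d -> R) :=
  [set f | adm (sq q) /\
    (CK rho f /\ thin rho D (sq q) k.+1%:R^-1 J (fun x l => f x l + v x l))].
have Oopen v q k J : CK_open rho (O v q k J).
  have [aq|naq] := pselect (adm (sq q)).
    rewrite (_ : O v q k J = [set f | CK rho f /\
      thin rho D (sq q) k.+1%:R^-1 J (fun x l => f x l + v x l)]); first exact: thin_open.
    by apply/seteqP; split => [f []//|f].
  by split=> f [].
pose null : K -> 'I_d -> R := fun _ _ => 0.
pose B v := \bigcup_q \bigcap_k \bigcup_J O v q k J.
have OC v q k J : O v q k J `<=` CK rho (d:=d) by move=> f [_ []].
have Bborel : CK_borel rho (B null).
  apply: CK_borel_bigcup => q; apply: CK_borel_bigcap => k.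
    by move=> f [J _ [_ []]].
  by apply: CK_borel_bigcup => J; apply: sub_gen_smallest.
have BC v : B v `<=` CK rho (d:=d) by move=> f [q _ /(_ 0%N I)[J _ [_ []]]].
have Bnull v : limit_law M Phi (B v) = 0%E.
  apply: (limit_law_null x0 M0 PhiC PhiS (Oopen v)) => [q k J f [aq [fC /thin_leS]]|q e e0].
    by move=> h; split.
  have [aq|naq] := pselect (adm (sq q)); last first.
    exists 0%N => J; exists 0%N => N _; rewrite big1 ?mulr_ge0 ?(ltW e0) // => c _.
    by case: asboolP => // -[].
  have [C hC] := admE _ aq.
  have [k hk] : exists k : nat, k.+1%:R^-1 * C <= e.
    have [k hk] := inv_small (divr_gt0 e0 (ltr_pwDr ltr01 (normr_ge0 C))).
    exists k; apply: le_trans (ler_norm _) _; rewrite normrM gtr0_norm ?invr_gt0 //.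
    move: hk; rewrite ltr_pdivlMr; last by rewrite ltr_pwDr.
    move/ltW; apply: le_trans; rewrite ler_wpM2l ?invr_ge0 //.
    by rewrite lerDl.
  exists k => J.
  (* [k] was fixed by [e] and the energy bound alone; only [N0] depends on [J]. *)
  have [N0 hN0] := kappa_unbounded lev (sq q) (\sum_(j < J.+1) dyad D j `^ (- sq q)) d0 D0.
  exists N0 => N /hN0 hN; have [m [p [z [p0 p1 pE]]]] := hC N.
  have k0 : 0 < k.+1%:R^-1 :> R by rewrite invr_gt0.
  have := Phithin (sq q) k.+1%:R^-1 N J v m p z C k0 p0 p1 hN pE.
  move=> h; apply: (@le_trans _ _ (k.+1%:R^-1 * C * (radix M N)%:R)); last first.
    by rewrite ler_wpM2r.
  apply: le_trans h; apply: ler_sum => c _; rewrite ler_nat.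
  by case: asboolP => // -[_ [_ th]]; case: asboolP.
exists (CK rho (d:=d) `\` B null); last first.
  move=> f [fC nB]; apply/eqP; rewrite eq_le dim_graph_le //=.
  apply/ereal_infP => _ [s [s0 Hs] <-]; rewrite leNgt; apply/negP => /(admdim _ s0)[q sq' aq].
  apply: nB; exists (pickle q) => // k _.
  have sE : sq (pickle q) = ratr q by rewrite /sq pickleK.
  have Hq : hausdorff_measure gdist (ratr q) (graph f) = 0%E.
    by apply: hausdorff_measure0_le Hs => //; [exact: graph_dist_ge0|exact: ltW].
  have k0 : 0 < k.+1%:R^-1 :> R by rewrite invr_gt0.
  have [J hJ] := graph_thin rhoM Kc D0 fC (adm0 _ aq) k0 Hq.
  exists J => //; rewrite /O /= sE; split=> //; split=> //.
  rewrite (_ : (fun x l => f x l + null x l) = f) //.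
  by apply/funext => x; apply/funext => l; rewrite /null addr0.
split; first by move=> f [].
split; first by move=> f [].
exists (B null).
  by split=> // f [fC nf]; apply: contrapT => nB; apply: nf.
exists (limit_law M Phi); first exact: (limit_law_prob x0 M0 PhiC PhiS).
(* The translate of [B null] by [v] is [B] taken at [- v], and [Bnull] holds for every shift. *)
move=> v vC; rewrite -(Bnull (fun x l => - v x l)); congr (limit_law M Phi _).
have E (f : K -> 'I_d -> R) q k J :
    O (fun x l => - v x l) q k J f <-> O null q k J (fun x l => f x l - v x l).
  rewrite /O /= (_ : (fun x l => f x l - v x l + null x l) = (fun x l => f x l - v x l)); last first.
    by apply/funext => x; apply/funext => l; rewrite /null addr0.
  split=> -[aq [fC th]]; split=> //; split=> //.
    exact: CKD fC (CKN vC).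
  have := CKD fC vC; rewrite (_ : (fun x l => f x l - v x l + v x l) = f) //.
  by apply/funext => x; apply/funext => l; rewrite subrK.
apply/seteqP; split => [_ [b [q _ hb] <-]|f [q _ hf]].
  exists q => // k _; have [J _ hJ] := hb k I; exists J => //; apply/E.
  rewrite (_ : (fun x l => b x l + v x l - v x l) = b) //.
  by apply/funext => x; apply/funext => l; rewrite addrK.
exists (fun x l => f x l - v x l).
  by exists q => // k _; have [J _ hJ] := hf k I; exists J => //; apply/E.
by apply/funext => x; apply/funext => l; rewrite subrK.
Qed.

End Prevalence.

Theorem theorem1p17 (R : realType) (K : Type) (rho : K -> K -> R) (d : nat) :
  is_metric rho -> mcompact rho -> uncountable K -> (0 < d)%N ->
  for_prevalent rho (fun f =>
    hausdorff_dim (graph_dist rho (d:=d)) (graph f) =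
    (hausdorff_dim rho [set: K] + (d%:R)%:E)%E).
Proof. by move=> rhoM Kc Ku d0; exact: graph_dim_prevalent. Qed.
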